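(* Let $r\ge1$ and regard the Hamiltonian algebra $H(2r)$ as a $W(1)$-module via $x\cdot D=[\Theta_H(x),D]$, where $\Theta_H(x_1^i\partial_1)=-D_H(x_1^ix_{r+1})=x_1^i\partial_1-ix_1^{i-1}x_{r+1}\partial_{r+1}$. Then $$H(2r)\cong V(0)^{\oplus(p^{2r-2}-1)}\oplus\Big(\bigoplus_{i=1}^{p-2}L(i)^{\oplus p^{2r-2}}\Big)\oplus V(p-1)^{\oplus(p^{2r-2}-1)}\oplus L(p-1)^{\oplus2}.$$ In particular, $$[H(2r)]=(2p^{2r-2}-2)[L(0)]+p^{2r-2}\sum_{j=1}^{p-2}[L(j)]+2p^{2r-2}[L(p-1)].$$
   Context: $\mathbb F$ is an algebraically closed field of characteristic $p>2$, $I=\{0,\dots,p-1\}$. $\mathcal A(2r)$ is the truncated polynomial algebra with basis $x^\alpha$, $\alpha\in I^{2r}$ ($x^\alpha x^\beta=x^{\alpha+\beta}$, $=0$ if outside $I^{2r}$), $\partial_i(x_j)=\delta_{ij}$. For $1\le i\le 2r$: $\sigma(i)=1$, $i'=i+r$ if $i\le r$; $\sigma(i)=-1$, $i'=i-r$ if $i>r$. $D_H(f)=\sum_{i=1}^{2r}\sigma(i)\partial_i(f)\partial_{i'}$, and $H(2r)=\mathrm{span}_{\mathbb F}\{D_H(x^\alpha)\mid\alpha\in I^{2r},\alpha\ne0,\alpha\ne(p-1,\dots,p-1)\}$. $W(1)$ is the Witt algebra with basis $x_1^i\partial_1$; $W(1)_{[i]}=\mathbb Fx_1^{i+1}\partial_1$,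 $W(1)_0=\bigoplus_{i\ge0}W(1)_{[i]}$, $W(1)_1=\bigoplus_{i\ge1}W(1)_{[i]}$. For $\lambda\in I$, $\mathbb F_\lambda$ is the one-dimensional $W(1)_0$-module with $x_1\partial_1$ acting by $\lambda$ and $W(1)_1$ by $0$; $V(\lambda)=u(W(1))\otimes_{u(W(1)_0)}\mathbb F_\lambda$ ($u$ = restricted enveloping algebra) and $L(\lambda)$ its unique simple quotient. $[M]$ is the formal sum of composition factors of $M$ with multiplicity. *)

(* Defs.v *)
From HB Require Import structures.
From mathcomp Require Import all_boot all_order all_algebra.
Set Implicit Arguments. Unset Strict Implicit. Unset Printing Implicit Defensive.
Import Order.TTheory GRing.Theory.
Local Open Scope ring_scope.

(* The Witt algebra W(1): basis e_a = x_1^a d_1, a : 'I_p (a = 0..p-1).      *)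
(* [e_a, e_b] = \sum_c wcoef a b c e_c, i.e. (b - a) e_(a+b-1) if a+b-1<p.   *)
Section Witt.
Variables (F : fieldType) (p : nat).

Definition wcoef (a b c : 'I_p) : F :=
  if (a + b == c + 1)%N then ((b : int) - (a : int))%:~R else 0.

(* Finite dimensional W(1)-modules, given by the matrices of the basis      *)
(* elements, acting on ROW vectors on the right: e_a . v = v *m act a.      *)
Record wmod := WMod { wdim : nat; wact : 'I_p -> 'M[F]_wdim }.

(* Lie module axiom: [e_a, e_b] . v = e_a . (e_b . v) - e_b . (e_a . v).    *)
Definition is_wrep n (rho : 'I_p -> 'M[F]_n) : Prop :=
  forall a b : 'I_p,
    rho b *m rho a - rho a *m rho b = \sum_(c < p) wcoef a b c *: rho c.

(* restricted (u(W(1))-) modules: e_a^p = e_a^[p] on the basis, where the   *)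
(* p-map is (x d)^[p] = x d and (x^a d)^[p] = 0 for a <> 1.                 *)
Definition restricted n (rho : 'I_p -> 'M[F]_n) : Prop :=
  forall a : 'I_p, rho a ^+ p = (if val a == 1%N then rho a else 0).

Definition is_whom n m (rho : 'I_p -> 'M[F]_n) (sigma : 'I_p -> 'M[F]_m)
  (f : 'M[F]_(n, m)) : Prop :=
  forall a : 'I_p, rho a *m f = f *m sigma a.

(* v spans a copy of F_lambda under W(1)_0 = span{x^a d | a >= 1}:         *)
(* x d acts by lambda, W(1)_1 = span{x^a d | a >= 2} acts by 0.              *)
Definition hw_vec n (rho : 'I_p -> 'M[F]_n) (lam : F) (v : 'rV[F]_n) : Prop :=
  (forall a : 'I_p, val a = 1%N -> v *m rho a = lam *: v) /\
  (forall a : 'I_p, (2 <= val a)%N -> v *m rho a = 0).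

(* M is (isomorphic to) V(lambda) = u(W(1)) (x)_{u(W(1)_0)} F_lambda:       *)
(* the universal property of the induced module (Frobenius reciprocity).    *)
Definition is_V (lam : nat) (M : wmod) : Prop :=
  is_wrep (wact M) /\ restricted (wact M) /\
  exists v : 'rV[F]_(wdim M),
    hw_vec (wact M) lam%:R v /\
    forall (m : nat) (sigma : 'I_p -> 'M[F]_m) (w : 'rV[F]_m),
      is_wrep sigma -> restricted sigma -> hw_vec sigma lam%:R w ->
      exists! f : 'M[F]_(wdim M, m), is_whom (wact M) sigma f /\ v *m f = w.

Definition is_simple n (rho : 'I_p -> 'M[F]_n) : Prop :=
  (0 < n)%N /\
  forall U : 'M[F]_n, (forall a, stablemx U (rho a)) ->
    (\rank U == 0%N) || row_full U.

Definition is_Lquot (V N : wmod) : Prop :=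
  is_wrep (wact N) /\ is_simple (wact N) /\
  exists f : 'M[F]_(wdim V, wdim N), is_whom (wact V) (wact N) f /\ row_full f.

End Witt.

(* Indices 1..2r of the paper are 0..2r-1 here.                             *)
Section Hamiltonian.
Variables (F : fieldType) (p r : nat).

Definition mono := {ffun 'I_(2 * r) -> 'I_p}.

(* W(2r): D (j, gamma) is the coefficient of x^gamma d_j *)
Definition Wt := {ffun 'I_(2 * r) * mono -> F^o}.

Definition primeN (i : nat) : nat := if (i < r)%N then (i + r)%N else (i - r)%N.
Definition sigmaH (i : nat) : F := if (i < r)%N then 1 else -1.

(* coefficient of x^gamma in x^alpha * d_i(x^beta) (truncated product) *)
Definition mulcoef (alpha beta gamma : mono) (i : 'I_(2 * r)) : F :=
  if [forall k, (val (alpha k) + val (beta k) == val (gamma k) + (k == i))%N]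
  then (val (beta i))%:R else 0.

(* Lie bracket of W(2r):
   [sum D_i d_i, sum E_j d_j] = sum_j (sum_i D_i d_i(E_j) - E_i d_i(D_j)) d_j *)
Definition wbracket (D E : Wt) : Wt :=
  [ffun jg : 'I_(2 * r) * mono =>
     \sum_(i : 'I_(2 * r)) \sum_(alpha : mono) \sum_(beta : mono)
       (D (i, alpha) * E (jg.1, beta) - E (i, alpha) * D (jg.1, beta))
       * mulcoef alpha beta jg.2 i].

(* D_H(x^alpha) = sum_i sigma(i) d_i(x^alpha) d_{i'}, for an exponent vector *)
(* alpha (given as a nat-valued function).                                 *)
Definition DH (alpha : 'I_(2 * r) -> nat) : Wt :=
  [ffun jg : 'I_(2 * r) * mono =>
     \sum_(i : 'I_(2 * r) | primeN i == val jg.1)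
       sigmaH i * (alpha i)%:R *
       (if [forall k, (val (jg.2 k) + (k == i) == alpha k)%N] then 1 else 0)].

Definition mono_nonzero (alpha : mono) : bool := [exists k, val (alpha k) != 0%N].
Definition mono_nontop (alpha : mono) : bool := [exists k, val (alpha k) != p.-1].

Definition Hspace : {vspace Wt} :=
  <<[seq DH (fun k => val ((alpha : mono) k)) |
      alpha : mono <- enum mono & mono_nonzero alpha && mono_nontop alpha]>>%VS.

Definition ThetaH (a : 'I_p) : Wt :=
  - DH (fun k : 'I_(2 * r) =>
          if val k == 0%N then val a else if val k == r then 1%N else 0%N).

Definition hact (a : 'I_p) (D : Wt) : Wt := wbracket (ThetaH a) D.

Definition sub_iso (U : {vspace Wt}) (M : wmod F p) : Prop :=
  exists b : 'I_(wdim M) -> Wt,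
    basis_of U [seq b k | k : 'I_(wdim M)] /\
    forall (a : 'I_p) (k : 'I_(wdim M)),
      hact a (b k) = \sum_(l < wdim M) wact M a k l *: b l.

Definition stable (U : {vspace Wt}) : Prop :=
  forall (a : 'I_p) (w : Wt), w \in U -> hact a w \in U.

(* the quotient U / U' (U' <= U stable) is isomorphic to the module M *)
Definition quot_iso (U' U : {vspace Wt}) (M : wmod F p) : Prop :=
  exists b : 'I_(wdim M) -> Wt,
    let B := <<[seq b k | k : 'I_(wdim M)]>>%VS in
    [/\ free [seq b k | k : 'I_(wdim M)], directv (U' + B), (U' + B)%VS = U &
    forall (a : 'I_p) (k : 'I_(wdim M)),
      hact a (b k) - \sum_(l < wdim M) wact M a k l *: b l \in U'].

Definition comp_series (U : {vspace Wt}) (s : seq {vspace Wt}) : Prop :=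
  [/\ (0 < size s)%N, nth 0%VS s 0 = 0%VS, last 0%VS s = U,
      forall i, (i < size s)%N -> stable (nth 0%VS s i) &
      forall i, (i.+1 < size s)%N ->
        [/\ (nth 0%VS s i <= nth 0%VS s i.+1)%VS,
            nth 0%VS s i != nth 0%VS s i.+1 &
            forall X : {vspace Wt}, stable X ->
              (nth 0%VS s i <= X)%VS -> (X <= nth 0%VS s i.+1)%VS ->
              X = nth 0%VS s i \/ X = nth 0%VS s i.+1]].

End Hamiltonian.

Local Open Scope nat_scope.
Definition summands (F : fieldType) (p r : nat) (V L : nat -> wmod F p) :
    seq (wmod F p) :=
  nseq (p ^ (2 * r - 2) - 1) (V 0%N) ++
  flatten [seq nseq (p ^ (2 * r - 2)) (L i) | i <- iota 1 (p - 2)] ++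
  nseq (p ^ (2 * r - 2) - 1) (V p.-1) ++
  nseq 2 (L p.-1).

Definition multL (p r j : nat) : nat :=
  if j == 0%N then (2 * p ^ (2 * r - 2) - 2)%N
  else if j == p.-1 then (2 * p ^ (2 * r - 2))%N
  else p ^ (2 * r - 2).

(* Main.v *)
(* Under [D_H], the W(1)-module H(2r) is the span of the monomials x^alpha other
   than 1 and the top one, modulo constants, with [Theta_H (x_1^a d_1)] sending
   x^i y^j m to (i - a j) x^(i+a-1) y^j m, where x = x_1, y = x_(r+1) and m is a
   monomial in the other variables.  For fixed j and m this is a density module
   M_j with basis x^0, ..., x^(p-1); it is generated by its highest weight vector
   x^(p-1) of weight p-1-j, so M_j = V(p-1-j) by dimension.  M_j is simple for
   0 < j < p-1, M_0 = V(p-1) has the constants as socle, and M_(p-1) = V(0) has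
   socle spanned by x^0, ..., x^(p-2).  Dropping the constant 1 from one copy of M_0
   and the top monomial from one copy of M_(p-1) leaves the two extra L(p-1).  The
   multiplicities then follow from the Jordan-Hoelder theorem. *)
Require Import Defs.
From HB Require Import structures.
From mathcomp Require Import all_boot all_order all_algebra.
From mathcomp Require Import zify ring.
Set Implicit Arguments. Unset Strict Implicit. Unset Printing Implicit Defensive.
Import Order.TTheory GRing.Theory.
Local Open Scope ring_scope.

(** * Module maps, quotients and simplicity in matrix form *)

Section ModuleGenerals.
Variables (F : fieldType) (p : nat).
Implicit Types n m k : nat.

(** [V] and [L] come without a basis or a dimension: [V lam] is known by its universal property,
    [L lam] as some simple quotient. The bound dim V <= p comes from the uniqueness half of that
    property: modulo the span of the vectors e_0^k v, the projection and the zero map both kill v,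
    hence agree. The existence half then maps V onto M_(p-1-lam). For lam = 0 and lam = p - 1, the
    module M_(p-1-lam) has a surjection onto an explicit simple module whose kernel lies in every
    nonzero submodule, and this forces [L lam] to be that simple module. The two extra L(p-1) are of
    different nature, a quotient of M_0 and a submodule of M_(p-1); the derivative x^(l+1) -> (l+1)
    x^l matches them. Truncation is the delicate point of the computations: where an exponent runs
    past p - 1, a term that could come back into range is killed by a coefficient divisible by p. *)

Definition wiso n m (rho : 'I_p -> 'M[F]_n) (sigma : 'I_p -> 'M[F]_m) : Prop :=
  exists f : 'M[F]_(n, m), [/\ is_whom rho sigma f, row_free f & row_full f].

Lemma row_full_inj n m k (h : 'M[F]_(n, m)) (A B : 'M[F]_(m, k)) :
  row_full h -> h *m A = h *m B -> A = B.
Proof.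
by case/row_fullP=> h' h'h e; rewrite -[A]mul1mx -[B]mul1mx -h'h -!mulmxA e.
Qed.

Lemma wiso_sym n m (rho : 'I_p -> 'M[F]_n) (sigma : 'I_p -> 'M[F]_m) :
  wiso rho sigma -> wiso sigma rho.
Proof.
case=> f [homf ff fu]; exists (pinvmx f); split.
- move=> a; apply: (row_full_inj fu).
  have fV : f *m pinvmx f = 1%:M by apply: mulmxVp.
  by rewrite mulmxA -homf -mulmxA fV mulmx1 (mulmxA f) fV mul1mx.
- by apply/row_freeP; exists f; rewrite mulVpmx.
- by apply/row_fullP; exists f; rewrite mulmxVp.
Qed.

Lemma wiso_trans n m k (rho : 'I_p -> 'M[F]_n) (sigma : 'I_p -> 'M[F]_m)
    (tau : 'I_p -> 'M[F]_k) :
  wiso rho sigma -> wiso sigma tau -> wiso rho tau.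
Proof.
case=> f [homf /row_freeP[f' ff'] /row_fullP[f'' f''f]].
case=> g [homg /row_freeP[g' gg'] /row_fullP[g'' g''g]].
exists (f *m g); split.
- by move=> a; rewrite mulmxA homf -!mulmxA homg.
- by apply/row_freeP; exists (g' *m f'); rewrite mulmxA -(mulmxA f) gg' mulmx1.
- by apply/row_fullP; exists (g'' *m f''); rewrite mulmxA -(mulmxA g'') f''f mulmx1.
Qed.

(** Vectors are rows, so [row_full h] says that h is onto and [pinvmx h] is a linear section of it;
    [pinvmx h *m g] is the map that g induces on the quotient by the kernel of h. *)
Lemma submx_ker_mul n m k (h : 'M[F]_(n, m)) (g : 'M[F]_(n, k)) :
  (kermx h <= kermx g)%MS -> row_full h -> h *m (pinvmx h *m g) = g.
Proof.
move=> sub fu; apply/eqP; rewrite mulmxA -subr_eq0 -{2}[g]mul1mx -mulmxBl.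
apply/eqP; apply/sub_kermxP; apply: submx_trans sub; apply/sub_kermxP.
by rewrite mulmxBl mul1mx -mulmxA mulVpmx // mulmx1 subrr.
Qed.

Lemma whom_factor n m k (rho : 'I_p -> 'M[F]_n) (sigma : 'I_p -> 'M[F]_m)
    (tau : 'I_p -> 'M[F]_k) (h : 'M[F]_(n, m)) (g : 'M[F]_(n, k)) :
  is_whom rho sigma h -> row_full h -> is_whom rho tau g ->
  (kermx h <= kermx g)%MS ->
  exists f : 'M[F]_(m, k), is_whom sigma tau f /\ h *m f = g.
Proof.
move=> homh fu homg sub; exists (pinvmx h *m g).
have hf := submx_ker_mul sub fu; split=> // a.
by apply: (row_full_inj fu); rewrite mulmxA -homh -mulmxA hf homg [in RHS]mulmxA hf.
Qed.

Lemma kermx_stable n m (rho : 'I_p -> 'M[F]_n) (sigma : 'I_p -> 'M[F]_m)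
    (h : 'M[F]_(n, m)) a : is_whom rho sigma h -> stablemx (kermx h) (rho a).
Proof.
by move=> homh; apply/sub_kermxP; rewrite -mulmxA homh mulmxA mulmx_ker mul0mx.
Qed.

Lemma simple_epi_iso n m (rho : 'I_p -> 'M[F]_n) (sigma : 'I_p -> 'M[F]_m)
    (h : 'M[F]_(n, m)) :
  is_simple rho -> (0 < m)%N -> is_whom rho sigma h -> row_full h ->
  wiso rho sigma.
Proof.
move=> [n0 simp] m0 homh fu; exists h; split=> //.
have /orP[] := simp (kermx h) (fun a => kermx_stable a homh).
- by rewrite mxrank_eq0 kermx_eq0.
- rewrite /row_full mxrank_ker => /eqP e.
  by move: fu; rewrite /row_full => /eqP fu; exfalso; move: (rank_leq_row h); lia.
Qed.

(** An injective h would be an isomorphism carrying the proper nonzero submodule U into the simple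
    module. *)
Lemma simple_no_sub n m (rho : 'I_p -> 'M[F]_n) (sigma : 'I_p -> 'M[F]_m)
    (h : 'M[F]_(n, m)) (U : 'M[F]_n) :
  is_simple sigma -> is_whom rho sigma h -> row_full h ->
  (forall a, stablemx U (rho a)) -> (0 < \rank U < n)%N -> kermx h != 0.
Proof.
move=> [m0 simp] homh fu stU /andP[U0 Un]; apply/negP; rewrite kermx_eq0 => fr.
have mn : m = n by rewrite -(eqP fu) (eqP fr).
have st a : stablemx <<U *m h>>%MS (sigma a).
  rewrite genmxE.
  by rewrite (eqmxMr _ (genmxE _)) -mulmxA -homh mulmxA submxMr //; apply: stU.
have /orP[] := simp _ st.
- by rewrite genmxE mxrankMfree // => /eqP e; rewrite e in U0.
- by rewrite /row_full genmxE mxrankMfree // => /eqP e; rewrite e mn ltnn in Un.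
Qed.

Lemma quotient_rep n m (rho : 'I_p -> 'M[F]_n) (C : 'M[F]_(n, m)) :
  row_full C -> (forall a, stablemx (kermx C) (rho a)) ->
  exists sigma : 'I_p -> 'M[F]_m, is_whom rho sigma C.
Proof.
move=> fu st; exists (fun a => pinvmx C *m (rho a *m C)) => a.
rewrite submx_ker_mul //; apply/sub_kermxP; rewrite mulmxA.
by apply/sub_kermxP; apply: st.
Qed.

Lemma whom_exp n m (rho : 'I_p -> 'M[F]_n) (sigma : 'I_p -> 'M[F]_m)
    (h : 'M[F]_(n, m)) a k :
  is_whom rho sigma h -> rho a ^+ k *m h = h *m sigma a ^+ k.
Proof.
move=> homh; elim: k => [|k IH]; first by rewrite !expr0 mulmx1 mul1mx.
by rewrite !exprS -!mulmxE -mulmxA IH !mulmxA homh.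
Qed.

Lemma quotient_is_wrep n m (rho : 'I_p -> 'M[F]_n) (sigma : 'I_p -> 'M[F]_m)
    (h : 'M[F]_(n, m)) :
  is_whom rho sigma h -> row_full h -> is_wrep rho -> is_wrep sigma.
Proof.
move=> homh fu rep a b; apply: (row_full_inj fu).
rewrite mulmxBr !mulmxA -!homh -!mulmxA -!homh !mulmxA -mulmxBl rep.
rewrite mulmx_suml mulmx_sumr; apply: eq_bigr => c _.
by rewrite -scalemxAl -scalemxAr homh.
Qed.

Lemma quotient_restricted n m (rho : 'I_p -> 'M[F]_n) (sigma : 'I_p -> 'M[F]_m)
    (h : 'M[F]_(n, m)) :
  is_whom rho sigma h -> row_full h -> restricted rho -> restricted sigma.
Proof.
move=> homh fu res a; apply: (row_full_inj fu).
by rewrite -(whom_exp a p homh) res; case: ifP => _; rewrite ?homh // mul0mx mulmx0.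
Qed.

End ModuleGenerals.

(** * Density modules of W(1) *)

Section DensityModules.
Variables (F : fieldType) (q : nat).
Notation p := q.+1.
(** The test [i + a == l + 1] expresses l = i + a - 1 without truncated subtraction. The size n is p
    for the full density modules and p - 1 for the simple subquotients of M_0 and M_(p-1). *)
Definition dens n (c : nat -> nat -> F) (a : 'I_p) : 'M[F]_n :=
  \matrix_(i, l) if (i + a == l + 1)%N then c i a else 0.

Lemma dens_delta n c (a : 'I_p) (i l : 'I_n) : (i + a = l + 1)%N ->
  delta_mx 0 i *m dens n c a = c i a *: delta_mx (0 : 'I_1) l.
Proof.
move=> e; rewrite -rowE; apply/rowP => k; rewrite !mxE /=.
have -> : (i + a == k + 1)%N = (k == l) by rewrite -val_eqE /=; lia.
by case: (k == l); rewrite ?mulr1 ?mulr0.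
Qed.

Lemma dens_delta0 n c (a : 'I_p) (i : 'I_n) : (i + a = 0 \/ n < i + a)%N ->
  delta_mx (0 : 'I_1) i *m dens n c a = 0.
Proof.
move=> e; rewrite -rowE; apply/rowP => k; rewrite !mxE.
by case: ifP => // /eqP ee; have := ltn_ord k; lia.
Qed.

Lemma dens_sub n c (U : 'M[F]_n) (a : 'I_p) (i l : 'I_n) :
  stablemx U (dens n c a) -> (i + a = l + 1)%N -> c i a != 0 ->
  (delta_mx (0 : 'I_1) i <= U)%MS -> (delta_mx (0 : 'I_1) l <= U)%MS.
Proof.
move=> st e c0 iU; have: (delta_mx (0 : 'I_1) i *m dens n c a <= U)%MS.
  by apply: submx_trans st; apply: submxMr.
by rewrite (dens_delta _ e) (eqmx_scale _ c0).
Qed.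

(* Lowering by [e_0] strips the top coefficient until only the constant is left. *)
Lemma dens_socle n c (U : 'M[F]_n) (v : 'rV[F]_n) (l0 : 'I_n) :
  (forall i, (0 < i < n)%N -> c i 0%N != 0) -> stablemx U (dens n c ord0) ->
  val l0 = 0%N -> (v <= U)%MS -> v != 0 -> (delta_mx (0 : 'I_1) l0 <= U)%MS.
Proof.
move=> hc st l00.
have [d /ltnW hd] := ubnP n.
have : forall l : 'I_n, (d <= l)%N -> v 0 l = 0.
  by move=> l; rewrite leqNgt (leq_trans (ltn_ord l) hd).
elim: d v {hd} => [|d IH] v hv vU v0.
  by case/eqP: v0; apply/rowP => l; rewrite hv // mxE.
have [dn|nd] := ltnP d n; last first.
  by apply: (IH v) => // l dl; have := ltn_ord l; lia.
have [e|ne] := eqVneq (v 0 (Ordinal dn)) 0.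
  apply: (IH v) => // l; rewrite leq_eqVlt => /orP[/eqP dl|]; last exact: hv.
  by rewrite -e; congr (v _ _); apply: val_inj.
case: d IH dn hv ne => [|d] IH dn hv ne.
  have -> : delta_mx 0 l0 = (v 0 l0)^-1 *: v.
    have el : l0 = Ordinal dn by apply: val_inj.
    apply/rowP => l; rewrite !mxE /= el; case: eqP => [->|/eqP nl].
      by rewrite mulVf.
    by rewrite (hv l) ?mulr0 ?lt0n.
  exact: scalemx_sub.
have dn' : (d < n)%N by lia.
have vm (l : 'I_n) : (v *m dens n c ord0) 0 l =
    (if insub l.+1 is Some k then v 0 k * c k 0%N else 0).
  rewrite mxE; case: insubP => [k _ /= ek|/= nk].
    rewrite (bigD1 k) //= big1 ?addr0 => [|i ni]; rewrite !mxE.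
      by case: eqP => //=; lia.
    by case: eqP => [/= ei|]; rewrite ?mulr0 //; move: ni; rewrite -val_eqE /=; lia.
  rewrite big1 // => i _; rewrite !mxE.
  by case: eqP => [/= ei|]; rewrite ?mulr0 //; have := ltn_ord i; move: nk => /=; lia.
apply: (IH (v *m dens n c ord0)).
- move=> l dl; rewrite vm; case: insubP => // k _ /= ek.
  by rewrite hv ?mul0r //; lia.
- by apply: submx_trans st; apply: submxMr.
- apply/eqP => /rowP /(_ (Ordinal dn')); rewrite vm mxE /=.
  case: insubP => [k _ /= ek /eqP|]; last by rewrite dn.
  have -> : k = Ordinal dn by apply: val_inj.
  by rewrite mulf_eq0 (negPf ne) /= (negPf (hc _ _)) //=; lia.
Qed.

(* [x^i] in the module of densities of weight [j]: [e_a x^i = (i - a j) x^(i+a-1)]. *)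
Definition densM j := dens p (fun i a => i%:R - (a * j)%:R).
(** M_0 modulo constants: index l stands for the class of x^(l+1). *)
Definition densN := dens q (fun i a => i.+1%:R).
(** The span of x^0, ..., x^(p-2) in M_(p-1): there i - a (p - 1) equals i + a in characteristic
    p. *)
Definition densS := dens q (fun i a => (i + a)%:R).
Definition triv (a : 'I_p) : 'M[F]_1 := 0.

Lemma triv_simple : is_simple triv.
Proof.
split=> // U _; have := rank_leq_row U; rewrite /row_full.
by case: (\rank U) => [|[|k]].
Qed.

Lemma submx_delta n (U : 'M[F]_n) : (forall l, delta_mx (0 : 'I_1) l <= U)%MS ->
  row_full U.
Proof.
by move=> h; rewrite -sub1mx; apply/row_subP => i; rewrite row1.
Qed.

Lemma nonzero_row n (U : 'M[F]_n) : (\rank U == 0%N) = false ->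
  exists2 v : 'rV_n, (v <= U)%MS & v != 0.
Proof.
rewrite mxrank_eq0 => /negbT /rowV0Pn[v vU v0]; by exists v.
Qed.

(** Each application of e_a moves the exponent by a - 1. The scalar stays unspecified because
    nilpotency of e_a only depends on where the exponent ends. *)
Lemma dens_exp_delta n c (a : 'I_p) k (i : 'I_n) :
  exists x (y : 'rV[F]_n), delta_mx (0 : 'I_1) i *m dens n c a ^+ k = x *: y /\
    (x = 0 \/ exists2 l : 'I_n, y = delta_mx 0 l & (i + k * a = l + k)%N).
Proof.
elim: k => [|k [x [y [e h]]]].
  exists 1, (delta_mx 0 i); rewrite expr0 mulmx1 scale1r; split=> //; right.
  by exists i => //; lia.
have eS : delta_mx 0 i *m dens n c a ^+ k.+1 = x *: (y *m dens n c a).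
  by rewrite exprSr -mulmxE mulmxA e scalemxAl.
case: h => [x0|[l yl el]].
  by exists 0, y; split; [rewrite eS x0 !scale0r | left].
case: (posnP (l + a)) => [la|la].
  exists 0, y; split; last by left.
  by rewrite eS yl dens_delta0 ?scale0r ?scaler0 //; left; lia.
have [kn|kn] := ltnP (l + a).-1 n; last first.
  exists 0, y; split; last by left.
  by rewrite eS yl dens_delta0 ?scale0r ?scaler0 //; right; lia.
exists (x * c l a), (delta_mx 0 (Ordinal kn)); split.
  rewrite eS yl (@dens_delta _ _ _ _ (Ordinal kn)) ?scalerA //=; lia.
by right; exists (Ordinal kn) => //=; lia.
Qed.

Hypothesis hchar : p \in [pchar F].

Lemma natr_char_neq0 k : (0 < k < p)%N -> k%:R != 0 :> F.
Proof.
move=> /andP[k0 kp]; rewrite -(dvdn_pcharf hchar).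
by apply/negP => /(dvdn_leq k0); rewrite leqNgt kp.
Qed.

(** Lowering leads from any nonzero vector to the class of x, and e_(l+1) takes x to x^(l+1) with
    coefficient 1. *)
Lemma densN_simple : (2 < p)%N -> is_simple densN.
Proof.
move=> hp2.
have q1 : (1 < q)%N by lia.
split=> [|U st]; first by lia.
case rU: (\rank U == 0%N) => //=.
have [v vU v0] := nonzero_row rU.
have q0 : (0 < q)%N by lia.
have s0 : (delta_mx (0 : 'I_1) (Ordinal q0) <= U)%MS.
  apply: dens_socle vU v0 => //; last exact: st.
  by move=> i hi; apply: natr_char_neq0; lia.
apply: submx_delta => l.
have hl : (l.+1 < p)%N by have := ltn_ord l; lia.
apply: (dens_sub (st (Ordinal hl)) _ _ s0) => /=; first by lia.
by rewrite oner_neq0.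
Qed.

(** Lowering leads to the constant 1, and e_(l+1) sends 1 to -(l+1) j x^l. The monomial x^(p-1)
    escapes this argument, since it would require e_p; for j = p - 1 this is what leaves room for a
    proper submodule. *)
Lemma densM_sub j (U : 'M[F]_p) (v : 'rV_p) : (0 < j < p)%N ->
  (forall a, stablemx U (densM j a)) -> (v <= U)%MS -> v != 0 ->
  forall l : 'I_p, (l < q)%N -> (delta_mx (0 : 'I_1) l <= U)%MS.
Proof.
move=> hj st vU v0 l lq.
have s0 : (delta_mx (0 : 'I_1) (ord0 : 'I_p) <= U)%MS.
  apply: dens_socle vU v0 => //; last exact: st.
  by move=> i hi; rewrite /= mul0n subr0; apply: natr_char_neq0; lia.
have hl : (l.+1 < p)%N by lia.
apply: (dens_sub (st (Ordinal hl)) _ _ s0) => /=; first by lia.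
by rewrite sub0r oppr_eq0 natrM mulf_neq0 ?natr_char_neq0.
Qed.

(** The missing x^(p-1) is obtained as e_2 x^(p-2), with coefficient p - 2 - 2j = -2 (j + 1),
    nonzero because p > 2 and j < p - 1. *)
Lemma densM_simple j : (2 < p)%N -> (0 < j < q)%N -> is_simple (densM j).
Proof.
move=> hp2 hj; split=> // U st.
case rU: (\rank U == 0%N) => //=.
have [v vU v0] := nonzero_row rU.
have hj' : (0 < j < p)%N by lia.
have sl := densM_sub hj' st vU v0.
apply: submx_delta => l; have [lq|ql] := ltnP l q; first exact: sl.
have hk : (q.-1 < p)%N by lia.
apply: (dens_sub (st (Ordinal hp2)) (i := Ordinal hk)) => /=.
- by have := ltn_ord l; lia.
- have -> : q.-1%:R - (2 * j)%:R = - (2 * j.+1)%:R :> F.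
    have : (p%:R : F) = 0 by apply: (pcharf0 hchar).
    have -> : p = (q.-1 + 2)%N by lia.
    rewrite natrD !natrM -[j.+1]addn1 natrD => /eqP.
    by rewrite addr_eq0 => /eqP ->; ring.
  by rewrite oppr_eq0 natrM mulf_neq0 ?natr_char_neq0 //; lia.
- by apply: sl => /=; lia.
Qed.

(** M_(p-1) is the module of one-forms, e_a (x^i dx) = (i + a) x^(i+a-1) dx, and the diagonal matrix
    is the differential x^(l+1) -> (l+1) x^l dx, which commutes with the action. *)
Lemma densN_densS : wiso densN densS.
Proof.
exists (diag_mx (\row_i (i.+1%:R : F))).
have u : diag_mx (\row_(i < q) (i.+1%:R : F)) \in unitmx.
  rewrite unitmxE det_diag unitfE; apply/prodf_neq0 => i _; rewrite mxE.
  by apply: natr_char_neq0; have := ltn_ord i; lia.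
split; rewrite ?row_free_unit ?row_full_unit //.
move=> a; apply/matrixP => i l; rewrite mul_diag_mx mul_mx_diag !mxE.
case: eqP => [e|_]; rewrite ?mulr0 ?mul0r //.
by rewrite e addn1.
Qed.

Lemma densM_mul j (a b : 'I_p) (i l : 'I_p) :
  (densM j b *m densM j a) i l =
  if (i + a + b == l + 2)%N then
    (i%:R - (b * j)%:R) * (i%:R + b%:R - 1 - (a * j)%:R) else 0.
Proof.
rewrite mxE; case: (posnP (i + b)) => [ib|ib].
  rewrite big1 => [|k _]; last by rewrite !mxE; case: eqP => [?|]; rewrite ?mul0r //; lia.
  have -> : i%:R = 0 :> F by (have -> : (i : nat) = 0%N by lia).
  have -> : (b : nat) = 0%N by lia.
  by rewrite mul0n subr0 mul0r if_same.
have [kp|kp] := ltnP (i + b).-1 p.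
  rewrite (bigD1 (Ordinal kp)) //= big1 ?addr0 => [|k nk]; last first.
    rewrite !mxE; case: eqP => [?|]; rewrite ?mul0r //.
    by move: nk; rewrite -val_eqE /=; lia.
  rewrite !mxE /=; have -> : (i + b == (i + b).-1 + 1)%N by lia.
  have -> : ((i + b).-1 + a == l + 1)%N = (i + a + b == l + 2)%N by lia.
  case: ifP => _; rewrite ?mulr0 //; congr (_ * (_ - _)).
  by rewrite -natrD -[in RHS](prednK ib) -natr1 addrK.
rewrite big1 => [|k _]; last first.
  by rewrite !mxE; case: eqP => [?|]; rewrite ?mul0r //; have := ltn_ord k; lia.
(* The intermediate exponent i + b - 1 is at least p, so the left side is 0. Only i + b - 1 = p
   followed by e_0 could return to the range, and then the second factor on the right is p = 0. *)
case: eqP => // e; have a0 : (a : nat) = 0%N by have := ltn_ord l; lia.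
have ibp : (i + b = p + 1)%N by have := ltn_ord l; lia.
by rewrite -natrD ibp natrD addrK a0 mul0n subr0 (pcharf0 hchar) mulr0.
Qed.

Lemma densM_wrep j : is_wrep (densM j).
Proof.
move=> a b; apply/matrixP => i l.
rewrite [LHS]mxE [X in _ + X]mxE !densM_mul summxE.
have -> : (i + b + a)%N = (i + a + b)%N by lia.
transitivity (if (i + a + b == l + 2)%N then (b%:R - a%:R) *
   (i%:R - (a%:R + b%:R - 1) * j%:R) else 0 : F).
  by case: ifP => _; rewrite ?subrr //; rewrite !natrM; ring.
symmetry; have wE (c : 'I_p) : (wcoef F a b c *: densM j c) i l =
  (if (a + b == c + 1)%N then b%:R - a%:R else 0) *
  (if (i + c == l + 1)%N then i%:R - (c * j)%:R else 0).
  by rewrite !mxE /wcoef; case: eqP => //; rewrite rmorphB /= !pmulrn.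
rewrite (eq_bigr _ (fun c _ => wE c)); case: (posnP (a + b)) => [ab|ab].
  rewrite big1 => [|k _]; last by case: eqP => [?|]; rewrite ?mul0r //; lia.
  have -> : (a : nat) = 0%N by lia.
  have -> : (b : nat) = 0%N by lia.
  by rewrite subrr mul0r if_same.
have [kp|kp] := ltnP (a + b).-1 p.
  rewrite (bigD1 (Ordinal kp)) //= big1 ?addr0 => [|k nk]; last first.
    case: eqP => [?|]; rewrite ?mul0r //.
    by move: nk; rewrite -val_eqE /=; lia.
  have -> : (a + b == (a + b).-1 + 1)%N by lia.
  have -> : (i + (a + b).-1 == l + 1)%N = (i + a + b == l + 2)%N by lia.
  case: ifP => _; rewrite ?mulr0 //; congr (_ * (_ - _)).
  by rewrite natrM -natrD -[in RHS](prednK ab) -natr1 addrK.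
rewrite big1 => [|k _]; last first.
  by case: eqP => [?|]; rewrite ?mul0r //; have := ltn_ord k; lia.
(* The bracket would be a multiple of e_p, which does not exist in W(1). Only i = 0 with a + b - 1 =
   p has a target in range, and there i - (a + b - 1) j vanishes modulo p. *)
case: eqP => // e; have i0 : (i : nat) = 0%N by have := ltn_ord l; lia.
have ibp : (a + b = p + 1)%N by have := ltn_ord l; lia.
by rewrite -natrD ibp natrD addrK i0 (pcharf0 hchar) mul0r subrr mulr0.
Qed.

(** The matrix of e_1 is diagonal with entries i - j in the prime field, which Frobenius fixes. For
    a <> 1 the power e_a^p would move exponents by p (a - 1), which leaves the range. *)
Lemma densM_restricted j : restricted (densM j).
Proof.
move=> a; case: ifP => [/eqP a1|na].
  have -> : densM j a = diag_mx (\row_(i < p) (i%:R - j%:R : F)).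
    apply/matrixP => i l; rewrite !mxE a1 mul1n eqn_add2r val_eqE.
    by case: eqP => _; rewrite ?mulr1n ?mulr0n.
  have dX k (d : 'rV[F]_p) : diag_mx d ^+ k = diag_mx (\row_i d 0 i ^+ k).
    elim: k => [|k IH].
      by apply/matrixP => i l; rewrite !mxE expr0.
    rewrite exprS IH -mulmxE mulmx_diag; congr diag_mx.
    by apply/rowP => i; rewrite !mxE exprS.
  rewrite dX; congr diag_mx; apply/rowP => i; rewrite !mxE.
  rewrite -!(pFrobenius_autE hchar) rmorphB /= !pFrobenius_autE.
  by rewrite -!(pFrobenius_autE hchar) !rmorph_nat.
apply/row_matrixP => i; rewrite row0 rowE.
have [x [y [e h]]] := dens_exp_delta (fun i a => i%:R - (a * j)%:R) a p i.
rewrite /densM e; case: h => [->|[l _ el]]; first by rewrite scale0r.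
exfalso; rewrite /= in na; move: na (ltn_ord l) (ltn_ord i) el.
case: (nat_of_ord a) => [|[|b]] // _; first by lia.
by rewrite !mulnS; nia.
Qed.
End DensityModules.

(** * Induced modules and their simple quotients *)

Section InducedModules.
Variables (F : fieldType) (q : nat).
Notation p := q.+1.
Hypothesis hchar : p \in [pchar F].

Section Generated.
Variables (n : nat) (rho : 'I_p -> 'M[F]_n) (lam : F) (v : 'rV[F]_n).
Hypotheses (rep : is_wrep rho) (res : restricted rho) (hw : hw_vec rho lam v).

Definition lowering : 'M[F]_(p, n) := \matrix_(k < p) (v *m rho ord0 ^+ k).

Lemma lowering_pow k : (v *m rho ord0 ^+ k <= lowering)%MS.
Proof.
have [kp|pk] := ltnP k p.
  have -> : v *m rho ord0 ^+ k = row (Ordinal kp) lowering by rewrite rowK.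
  exact: row_sub.
have rp : rho ord0 ^+ p = 0 by rewrite res.
by rewrite -(subnK pk) exprD rp mulr0 mulmx0 sub0mx.
Qed.

(** Induction on k, for all a at once: moving e_a past one factor e_0 costs [e_a, e_0], a
    combination of the e_c, to which the induction hypothesis applies. The base case is the highest
    weight condition on v. *)
Lemma lowering_stable a : (lowering *m rho a <= lowering)%MS.
Proof.
have st0 : (lowering *m rho ord0 <= lowering)%MS.
  apply/row_subP => k; rewrite row_mul rowK -mulmxA mulmxE -exprSr.
  exact: lowering_pow.
suff H k : forall a, (v *m rho ord0 ^+ k *m rho a <= lowering)%MS.
  by apply/row_subP => k; rewrite row_mul rowK.
elim: k => [|k IH] {}a.
  rewrite expr0 mulmx1.
  have v0 : (v <= lowering)%MS by have := lowering_pow 0; rewrite expr0 mulmx1.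
  case: hw => h1 h2; case e: (val a) => [|[|k]].
  - have -> : a = ord0 by apply: val_inj.
    by apply: submx_trans st0; apply: submxMr.
  - by rewrite h1 // scalemx_sub.
  - by rewrite h2 ?sub0mx // e.
rewrite exprSr -mulmxE -!mulmxA.
have := rep a ord0 => /eqP; rewrite subr_eq => /eqP ->.
rewrite !mulmxDr addmx_sub //.
  rewrite !mulmx_sumr; apply: summx_sub => c _.
  by rewrite -!scalemxAr scalemx_sub // mulmxA.
by rewrite !mulmxA; apply: submx_trans st0; apply: submxMr.
Qed.
End Generated.

(** The row space U of [lowering] is a submodule containing v, so the projection C onto V/U and the
    zero map both send v to 0. Uniqueness in the universal property gives C = 0, hence V = U, which
    is spanned by p vectors. *)
Lemma induced_dim (lam : nat) (V : wmod F p) : is_V lam V -> (wdim V <= p)%N.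
Proof.
case=> rep [res [v [hw univ]]].
(* [cokermx U] is square; its column base has the same kernel U but is onto, with the dimension of
   V/U as its number of columns. *)
set U := lowering (wact V) v; set C := col_base (cokermx U).
have fuC : row_full C by apply: col_base_full.
have kC (m : nat) (x : 'M_(m, _)) : (x <= kermx C)%MS = (x <= U)%MS.
  apply/sub_kermxP/idP => h.
    by rewrite submxE -(mulmx_base (cokermx U)) mulmxA h mul0mx.
  apply: (row_free_inj (row_base_free (cokermx U))).
  by rewrite mul0mx -mulmxA mulmx_base; apply/eqP; rewrite -submxE.
have [|sigma homC] := @quotient_rep F p _ _ (wact V) C fuC.
  move=> a; rewrite kC; apply: (submx_trans _ (lowering_stable rep res hw a)).
  by apply: submxMr; rewrite -kC.
have vC : v *m C = 0.
  apply/sub_kermxP; rewrite kC.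
  by have := lowering_pow v res 0; rewrite expr0 mulmx1.
have hw0 : hw_vec sigma (lam%:R : F) 0.
  by split=> a _; rewrite mul0mx ?scaler0.
have [f [_ uf]] := univ _ _ _ (quotient_is_wrep homC fuC rep)
  (quotient_restricted homC fuC res) hw0.
have C0 : C = 0.
  rewrite -(uf C) //; apply: uf; split; last by rewrite mulmx0.
  by move=> a; rewrite mulmx0 mul0mx.
have : (1%:M <= U)%MS by rewrite -kC C0; apply/sub_kermxP; rewrite mulmx0.
rewrite sub1mx => /eqP <-; exact: rank_leq_row.
Qed.

Lemma densM_hw lam : (lam < p)%N ->
  hw_vec (densM F (q - lam)) lam%:R (delta_mx 0 (ord_max : 'I_p)).
Proof.
move=> hl; split=> a ha.
  rewrite (@dens_delta _ _ _ _ _ _ ord_max) ?ha //=; congr (_ *: _).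
  by rewrite -natrB mul1n ?leq_subr // subKn.
by apply: dens_delta0; right; move: ha => /=; lia.
Qed.

Lemma V_iso lam (V : wmod F p) : (lam < p)%N -> is_V lam V ->
  wiso (wact V) (densM F (q - lam)).
Proof.
move=> hl isV; have dV := induced_dim isV; case: isV => rep [res [v [hw univ]]].
have [f [[homf vf] _]] := univ _ _ _ (densM_wrep hchar (q - lam))
  (densM_restricted hchar (q - lam)) (densM_hw hl).
suff fu : row_full f.
  exists f; split=> //; rewrite /row_free.
  by have := rank_leq_row f; rewrite (eqP fu); lia.
rewrite -sub1mx; apply/row_subP => i; rewrite row1.
(* Descending induction on i, through k = q - i: the image of f contains x^(p-1), the image of v,
   and e_0 x^(i+1) = (i+1) x^i with i + 1 invertible. *)
have [k e] : exists k, (q = i + k)%N by exists (q - i)%N; have := ltn_ord i; lia.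
elim: k i e => [|k IH] i e.
  have -> : i = ord_max by apply: val_inj => /=; lia.
  by rewrite -vf submxMl.
have ip : (i.+1 < p)%N by lia.
have := IH (Ordinal ip); rewrite /= => /(_ ltac:(lia)) h.
have : (delta_mx (0 : 'I_1) (Ordinal ip) *m densM F (q - lam) ord0 <= f)%MS.
  apply: (submx_trans (submxMr _ h)).
  by rewrite -homf submxMl.
rewrite (@dens_delta _ _ _ _ _ _ i) /=; last by lia.
rewrite mul0n subr0 (eqmx_scale _ (natr_char_neq0 hchar _)) //; lia.
Qed.

Variables (V L : nat -> wmod F p).
Hypotheses (hp2 : (2 < p)%N)
  (hV : forall lam : nat, (lam < p)%N -> is_V lam (V lam))
  (hL : forall lam : nat, (lam < p)%N -> is_Lquot (V lam) (L lam)).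

Lemma densM_epi_L lam : (lam < p)%N ->
  exists h : 'M[F]_(p, wdim (L lam)),
    is_whom (densM F (q - lam)) (wact (L lam)) h /\ row_full h.
Proof.
move=> hl; have [f [homf /row_freeP[f' ff'] fu]] := wiso_sym (V_iso hl (hV hl)).
have [_ [_ [g [homg /row_fullP[g' g'g]]]]] := hL hl.
exists (f *m g); split.
  by move=> a; rewrite mulmxA homf -!mulmxA homg.
case/row_fullP: fu => f'' f''f.
by apply/row_fullP; exists (g' *m f''); rewrite mulmxA -(mulmxA g') f''f mulmx1.
Qed.

Lemma L_iso_mid lam : (0 < lam < q)%N -> wiso (wact (L lam)) (densM F (q - lam)).
Proof.
move=> hl; have hl' : (lam < p)%N by lia.
have [h [homh fu]] := densM_epi_L hl'; apply: wiso_sym.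
have [_ [[L0 _] _]] := hL hl'.
by apply: (simple_epi_iso _ L0 homh fu); apply: densM_simple => //; lia.
Qed.

(** The surjection h onto [L lam] is not injective, since ker pi would then give a proper nonzero
    submodule of a simple module. So ker h is nonzero and contains ker pi, h factors through pi, and
    the simple module tau maps onto [L lam]. *)
Lemma L_iso_quot n lam (tau : 'I_p -> 'M[F]_n) (pi : 'M[F]_(p, n)) :
  (lam < p)%N -> is_simple tau -> is_whom (densM F (q - lam)) tau pi ->
  row_full pi -> (n < p)%N ->
  (forall (U : 'M[F]_p) (v : 'rV_p),
    (forall a, stablemx U (densM F (q - lam) a)) -> (v <= U)%MS -> v != 0 ->
    (kermx pi <= U)%MS) ->
  wiso (wact (L lam)) tau.
Proof.
move=> hl stau hompi fupi np hU.
have [h [homh fu]] := densM_epi_L hl.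
have [_ [sL _]] := hL hl.
have K0 : kermx h != 0.
  apply: (simple_no_sub sL homh fu (U := kermx pi)) => [a|].
    exact: kermx_stable hompi.
  rewrite mxrank_ker (eqP fupi); case: stau => n0 _; lia.
have /rowV0Pn[v vK v0] := K0.
have sub := hU _ v (fun a => kermx_stable a homh) vK v0.
have [f [homf pf]] := whom_factor hompi fupi homh sub.
apply: wiso_sym; apply: (simple_epi_iso stau _ homf); first by case: sL.
by case/row_fullP: fu => h' e; apply/row_fullP; exists (h' *m pi); rewrite -mulmxA pf.
Qed.

Lemma L_iso_top : wiso (wact (L q)) (@densN F q).
Proof.
(* The projection of M_0 modulo constants: x^0 goes to 0 and x^(l+1) to the basis vector of index
   l. *)
pose pi : 'M[F]_(p, q) := \matrix_(i, l) (i == lift ord0 l)%:R.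
have piE (i : 'I_p) (l : 'I_q) : pi i l = (i == l.+1 :> nat)%:R.
  by rewrite mxE -val_eqE /= /bump leq0n add1n.
have pi0 : delta_mx 0 (ord0 : 'I_p) *m pi = 0 :> 'rV_q.
  by apply/rowP => l; rewrite -rowE mxE piE mxE.
have piS (l : 'I_q) : delta_mx 0 (lift ord0 l : 'I_p) *m pi = delta_mx (0 : 'I_1) l.
  apply/rowP => k; rewrite -rowE mxE piE /= /bump leq0n add1n eqSS !mxE /=.
  by rewrite val_eqE eq_sym.
apply: (@L_iso_quot _ q _ pi) => //; rewrite ?subnn.
- exact: densN_simple.
- move=> a; apply/row_matrixP => i; rewrite !row_mul !rowE -!mulmxA.
  have := unliftP ord0 i; case=> [l|] ->; last first.
    rewrite (mulmxA _ pi) pi0 mul0mx; case: (posnP a) => a0.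
      by rewrite mulmxA dens_delta0 ?mul0mx //=; left.
    have ap : (a.-1 < p)%N by have := ltn_ord a; lia.
    rewrite mulmxA (@dens_delta _ _ _ _ _ _ (Ordinal ap)) /=; last by lia.
    by rewrite muln0 subrr scale0r mul0mx.
  move: l => /= l; rewrite mulmxA [RHS]mulmxA piS.
  case: (ltnP q (l + a)) => la.
    by rewrite !dens_delta0 ?mul0mx //=; right; rewrite ?/bump ?leq0n; lia.
  have lap : (l + a < p)%N by lia.
  rewrite (@dens_delta _ _ _ _ _ _ (Ordinal lap)) /=; last by rewrite /bump; lia.
  rewrite /bump leq0n add1n muln0 subr0 -scalemxAl.
  case: (posnP (l + a)) => la0.
    have -> : Ordinal lap = ord0 by apply: val_inj.
    by rewrite pi0 scaler0 dens_delta0 //; left.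
  have laq : ((l + a).-1 < q)%N by lia.
  rewrite (@dens_delta _ _ _ _ _ _ (Ordinal laq)) /=; last by lia.
  have -> : Ordinal lap = lift ord0 (Ordinal laq).
    by apply: val_inj => /=; rewrite /bump; lia.
  by rewrite piS.
- by rewrite -sub1mx; apply/row_subP => i; rewrite row1 -piS submxMl.
- move=> U v st vU v0.
  have s0 : (delta_mx (0 : 'I_1) (ord0 : 'I_p) <= U)%MS.
    apply: dens_socle vU v0 => //; last exact: st.
    by move=> i hi /=; rewrite mul0n subr0; apply: natr_char_neq0 => //; lia.
  apply/rV_subP => u /sub_kermxP upi.
  suff -> : u = u 0 ord0 *: delta_mx 0 ord0 by rewrite scalemx_sub.
  apply/rowP => i; rewrite !mxE; have := unliftP ord0 i; case=> [l|] ->.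
    have /rowP/(_ l) := upi; rewrite !mxE (bigD1 (lift ord0 l)) //= piE.
    rewrite /= /bump leq0n add1n eqxx mulr1 big1 ?addr0 => [|k nk].
      by rewrite mulr0.
    rewrite piE; case: eqP => [e|]; rewrite ?mulr0 //.
    by case/eqP: nk; apply: val_inj; rewrite /= /bump e.
  by rewrite eqxx mulr1.
Qed.

(** On M_(p-1) the coefficient of x^(p-1) is a map to the trivial module: e_a x^i reaches x^(p-1)
    only when i + a = p, and its coefficient i + a is then 0. In terms of one-forms this is the
    class modulo exact forms. *)
Lemma L_iso_triv : wiso (wact (L 0)) (@triv F q).
Proof.
pose pi : 'M[F]_(p, 1) := delta_mx ord_max 0.
have piE (i : 'I_p) : delta_mx (0 : 'I_1) i *m pi = (i == q :> nat)%:R.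
  apply/rowP => l; rewrite -rowE !mxE (ord1 l) eqxx andbT -val_eqE /=.
  by case: eqP => _; rewrite ?mulr1n // mxE.
apply: (@L_iso_quot _ 0 _ pi) => //; rewrite ?subn0.
- exact: triv_simple.
- move=> a; rewrite /triv mulmx0; apply/row_matrixP => i.
  rewrite row_mul rowE row0; case: (posnP (i + a)) => ia0.
    by rewrite dens_delta0 ?mul0mx //; left.
  case: (ltnP p (i + a)) => ia.
    by rewrite dens_delta0 ?mul0mx //; right.
  have iap : ((i + a).-1 < p)%N by lia.
  rewrite (@dens_delta _ _ _ _ _ _ (Ordinal iap)) /=; last by lia.
  rewrite -scalemxAl piE /=; case: eqP => e; rewrite ?scaler0 //.
  have -> : i%:R - (a * q)%:R = (i + a)%:R - (a * p)%:R :> F.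
    by rewrite mulnS !natrD; ring.
  have -> : (i + a)%N = p by lia.
  by rewrite natrM (pcharf0 hchar) mulr0 subrr scale0r.
- rewrite -sub1mx; have -> : 1%:M = delta_mx 0 ord_max *m pi :> 'M_1.
    by rewrite piE eqxx.
  exact: submxMl.
- by lia.
- move=> U v st vU v0; have hq : (0 < q < p)%N by lia.
  have sl := densM_sub hchar hq st vU v0.
  apply/rV_subP => u /sub_kermxP /rowP/(_ 0); rewrite !mxE => upi.
  rewrite [u]row_sum_delta; apply: summx_sub => l _.
  have [lq|ql] := ltnP l q; first by apply: scalemx_sub; apply: sl.
  have -> : l = ord_max by apply: val_inj => /=; have := ltn_ord l; lia.
  move: upi; rewrite (bigD1 ord_max) //= mxE !eqxx mulr1 big1 ?addr0.
    by move=> ->; rewrite scale0r sub0mx.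
  by move=> i ni; rewrite mxE (negPf ni) mulr0.
Qed.
End InducedModules.

(** * Brackets of monomial vector fields and independence of the D_H(x^alpha) *)

Section Bracket.
Variables (F : fieldType) (p r : nat).
Local Notation I := 'I_(2 * r).
Local Notation W := (Wt F p r).

Lemma wbracket_anti (D E : W) : wbracket D E = - wbracket E D.
Proof.
apply/ffunP => jg; rewrite !ffunE -sumrN; apply: eq_bigr => i _.
rewrite -sumrN; apply: eq_bigr => al _; rewrite -sumrN; apply: eq_bigr => be _.
by rewrite -[RHS]mulNr opprB.
Qed.

Lemma wbracket_linear (D : W) : linear (wbracket D).
Proof.
move=> c E E'; apply/ffunP => jg; rewrite !ffunE.
rewrite scaler_sumr -big_split; apply: eq_bigr => i _.
rewrite scaler_sumr -big_split; apply: eq_bigr => al _.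
rewrite scaler_sumr -big_split; apply: eq_bigr => be _ /=.
rewrite !ffunE /GRing.scale /=; ring.
Qed.

HB.instance Definition _ (D : W) :=
  GRing.isLinear.Build F W W _ (wbracket D) (wbracket_linear D).

HB.instance Definition _ (a : 'I_p) :=
  GRing.isLinear.Build F W W _ (hact a) (wbracket_linear (ThetaH F r a)).

(* Exponents live in [int] so that subtraction is exact; [vf e j] is
   [x^e d_j], which vanishes unless all exponents lie in [0, p - 1]. *)
Definition expo := {ffun I -> int}.
Definition mexpo (g : mono p r) : expo := [ffun k => (val (g k))%:Z].
Definition nexpo (g : I -> nat) : expo := [ffun k => (g k)%:Z].
Definition ebase (i : I) : expo := [ffun k => (k == i)%:Z].
Definition vf (e : expo) (j : I) : W :=
  [ffun jg => ((jg.1 == j) && (mexpo jg.2 == e))%:R].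
Definition inrange (e : expo) := forall k, (0 <= e k < p%:Z)%R.

Lemma mexpo_inj : injective mexpo.
Proof.
move=> f g /ffunP e; apply/ffunP => k; apply: val_inj.
by have := e k; rewrite !ffunE => -[].
Qed.

Lemma inrange_mexpo e : inrange e -> exists g, e = mexpo g.
Proof.
move=> h; have hk k : (absz (e k) < p)%N by have := h k; lia.
exists [ffun k => Ordinal (hk k)]; apply/ffunP => k; rewrite !ffunE /=.
by have := h k; lia.
Qed.

Lemma mexpo_range g : inrange (mexpo g).
Proof. by move=> k; rewrite ffunE /=; have := ltn_ord (g k); lia. Qed.

Lemma inrange_subbase (al : mono p r) i :
  mexpo al i != 0 -> inrange (mexpo al - ebase i).
Proof.
rewrite ffunE /= => n0 k; rewrite !ffunE /=; have := ltn_ord (al k).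
by case: (eqVneq k i) => [->|_] /=; lia.
Qed.

Lemma vf_mexpo m i j g : vf (mexpo m) i (j, g) = ((j == i) && (g == m))%:R.
Proof. by rewrite ffunE /= (inj_eq mexpo_inj). Qed.

Lemma vf_notin e j : ~ inrange e -> vf e j = 0.
Proof.
move=> h; apply/ffunP => -[k g]; rewrite !ffunE /=.
rewrite [_ == e](_ : _ = false) ?andbF //; apply/eqP => e'.
by apply: h; rewrite -e'; apply: mexpo_range.
Qed.

Lemma sum_vf (G : I -> mono p r -> mono p r -> F) (m n : mono p r) i j k :
  \sum_(i' : I) \sum_(al : mono p r) \sum_(be : mono p r)
    (vf (mexpo m) i (i', al) * vf (mexpo n) j (k, be)) * G i' al be
  = (k == j)%:R * G i m n.
Proof.
rewrite (bigD1 i) //= [X in _ + X]big1 ?addr0; last first.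
  move=> i' ni; rewrite big1 // => al _; rewrite big1 // => be _.
  by rewrite vf_mexpo (negPf ni) !mul0r.
rewrite (bigD1 m) //= [X in _ + X]big1 ?addr0; last first.
  move=> al na; rewrite big1 // => be _.
  by rewrite vf_mexpo (negPf na) andbF !mul0r.
rewrite (bigD1 n) //= [X in _ + X]big1 ?addr0; last first.
  by move=> be nb; rewrite !vf_mexpo (negPf nb) andbF mulr0 mul0r.
by rewrite !vf_mexpo !eqxx mul1r andbT.
Qed.

Lemma mulcoefE (m n g : mono p r) i :
  mulcoef F m n g i =
  (mexpo g == mexpo m + mexpo n - ebase i)%:R * (mexpo n i)%:~R.
Proof.
rewrite /mulcoef; have -> : [forall k, (val (m k) + val (n k) ==
   val (g k) + (k == i))%N] = (mexpo g == mexpo m + mexpo n - ebase i).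
  apply/forallP/eqP => [h|/ffunP h k].
    by apply/ffunP => k; have := h k; rewrite !ffunE; case: (k == i) => /= /eqP; lia.
  by have := h k; rewrite !ffunE; case: (k == i) => /=; lia.
by case: eqP; rewrite ?mul0r ?mul1r // ffunE.
Qed.

Lemma wbracket_vf al be i j : inrange al -> inrange be ->
  wbracket (vf al i) (vf be j) =
  (be i)%:~R *: vf (al + be - ebase i) j - (al j)%:~R *: vf (al + be - ebase j) i.
Proof.
move=> /inrange_mexpo[m ->] /inrange_mexpo[n ->].
apply/ffunP => -[k g]; rewrite [LHS]ffunE /=.
transitivity ((k == j)%:R * mulcoef F m n g i - (k == i)%:R * mulcoef F n m g j).
  rewrite -(sum_vf (fun i' a b => mulcoef F a b g i')).
  rewrite -[X in _ = _ - X](sum_vf (fun i' a b => mulcoef F a b g i')).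
  rewrite -sumrB; apply: eq_bigr => i' _.
  rewrite -sumrB; apply: eq_bigr => a _; rewrite -sumrB; apply: eq_bigr => b _.
  by rewrite mulrBl.
rewrite !mulcoefE !ffunE /= /GRing.scale /= [mexpo n + _]addrC.
by congr (_ - _); rewrite mulrA mulrC -natrM mulnb.
Qed.

Lemma primeN_lt (i : I) : (primeN r i < 2 * r)%N.
Proof. by rewrite /primeN; have := ltn_ord i; case: ifP; lia. Qed.
Definition primeI (i : I) : I := Ordinal (primeN_lt i).

Lemma primeIK : involutive primeI.
Proof.
move=> i; apply: val_inj; rewrite /= /primeN.
by have := ltn_ord i; case: ifP => //; case: ifP; lia.
Qed.

Lemma primeI_eq (i j : I) : (primeI i == j) = (i == primeI j).
Proof. by rewrite -{2}[i]primeIK (inj_eq (inv_inj (primeIK))). Qed.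

(** D_H for arbitrary integer exponents. Each component drops out when its own monomial leaves the
    range, so brackets can be computed before deciding whether the resulting exponent is
    admissible. *)
Definition DHz (B : expo) : W :=
  \sum_(i : I) (sigmaH F r i * (B i)%:~R) *: vf (B - ebase i) (primeI i).

Lemma DH_DHz al : DH F p al = DHz (nexpo al).
Proof.
apply/ffunP => -[j g]; rewrite !ffunE sum_ffunE /= big_mkcond /=.
apply: eq_bigr => i _; rewrite !ffunE /= /GRing.scale /=.
have -> : [forall k, (val (g k) + (k == i) == al k)%N] =
   (mexpo g == nexpo al - ebase i).
  apply/forallP/eqP => [h|/ffunP h k].
    by apply/ffunP => k; have := h k; rewrite !ffunE; case: (k == i) => /= /eqP; lia.
  by have := h k; rewrite !ffunE; case: (k == i) => /=; lia.
have -> : (primeN r i == j :> nat) = (j == primeI i) by rewrite -val_eqE eq_sym.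
by case: (j == primeI i); case: eqP; rewrite ?mulr1 ?mulr0.
Qed.

Definition DHm (al : mono p r) : W := DH F p (fun k => val (al k)).

Lemma DHm_DHz al : DHm al = DHz (mexpo al).
Proof. by rewrite /DHm DH_DHz. Qed.

Lemma DHm_coef al i g : DHm al (primeI i, g) =
  sigmaH F r i * (val (al i))%:R * (mexpo g == mexpo al - ebase i)%:R.
Proof.
rewrite DHm_DHz sum_ffunE (bigD1 i) //= big1 ?addr0 => [|j nj].
  by rewrite !ffunE eqxx /GRing.scale.
by rewrite !ffunE /= (inj_eq (inv_inj primeIK)) eq_sym (negPf nj) scaler0.
Qed.

Lemma free_map (T : eqType) (vT : vectType F) (f : T -> vT) (s : seq T) :
  uniq s ->
  (forall c : T -> F, \sum_(x <- s) c x *: f x = 0 -> {in s, forall x, c x = 0}) ->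
  free (map f s).
Proof.
move=> us h; change (free (map_tuple f (in_tuple s))); apply/freeP => k hk i.
(* Coefficients indexed by positions become a function on elements; [uniq] makes the position of an
   element of s unambiguous, and 0 is the value outside s. *)
pose c x := if insub (index x s) is Some j then k j else 0.
have ci (j : 'I_(size s)) x0 : c (nth x0 s j) = k j.
  by rewrite /c index_uniq // valK.
have x0 : T by case: (s) i => [[]|x ? _].
rewrite -(ci i x0); apply: h; last exact: mem_nth.
rewrite (big_nth x0) big_mkord -[RHS]hk; apply: eq_bigr => j _.
by rewrite ci /= (nth_map x0).
Qed.

(** If alpha_k is nonzero, x^(alpha - e_k) d_(k') occurs in D_H(x^beta) for beta = alpha only, with
    coefficient plus or minus alpha_k, invertible since 0 < alpha_k < p. *)
Lemma DHm_free (s : seq (mono p r)) : p \in [pchar F] -> uniq s ->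
  {in s, forall al, mono_nonzero al} -> free (map DHm s).
Proof.
move=> hchar us nz; apply: free_map => // c hc al als.
have /existsP[k ak] := nz _ als.
have ak' : mexpo al k != 0 by rewrite ffunE.
have /inrange_mexpo[g eg] := inrange_subbase ak'.
have := congr1 (fun D : W => D (primeI k, g)) hc.
rewrite sum_ffunE (bigD1_seq al) //= big1 ?addr0 => [|be nb]; last first.
  rewrite ffunE DHm_coef -eg; case: eqP => [/addIr/mexpo_inj e|_].
    by rewrite e eqxx in nb.
  by rewrite mulr0 scaler0.
rewrite [X in _ = X -> _]ffunE ffunE DHm_coef -eg eqxx mulr1 /GRing.scale /= => /eqP.
rewrite !mulf_eq0 => /orP[/eqP //|/orP[|]].
  by rewrite /sigmaH; case: ifP => _; rewrite ?oppr_eq0 oner_eq0.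
rewrite -(dvdn_pcharf hchar) => /dvdn_leq.
by rewrite lt0n => /(_ ak); rewrite leqNgt ltn_ord.
Qed.

End Bracket.

(** * The action of Theta_H(x_1^a d_1) on D_H(x^alpha) *)

Section Action.
Variables (F : fieldType) (p r : nat).
Local Notation I := 'I_(2 * r).
Local Notation W := (Wt F p r).

Lemma expo_ac1 (x y u v w : expo r) : x - u + (y - v) - w = y + x - u - w - v.
Proof. by apply/ffunP => k; rewrite !ffunE; lia. Qed.

Lemma expo_ac2 (x y u v w : expo r) : x - u + (y - v) - w = y + x - w - u - v.
Proof. by apply/ffunP => k; rewrite !ffunE; lia. Qed.

Lemma expo_ac3 (x y u v w : expo r) : x - u + (y - v) - w = y + x - v - u - w.
Proof. by apply/ffunP => k; rewrite !ffunE; lia. Qed.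

Variables (i0 ir : I).
Hypotheses (vi0 : val i0 = 0%N) (vir : val ir = r).

Lemma r_gt0 : (0 < r)%N.
Proof. by have := ltn_ord ir; move: vir => /=; lia. Qed.

Lemma primeI_i0 : primeI i0 = ir.
Proof.
by apply: val_inj; move: vi0 vir r_gt0; rewrite /= /primeN => -> -> ->.
Qed.

Lemma primeI_ir : primeI ir = i0.
Proof. by rewrite -primeI_i0 primeIK. Qed.

Lemma i0_neq_ir : i0 != ir.
Proof. by rewrite -val_eqE vi0 vir; have := r_gt0; case: (r). Qed.

Hypothesis hp1 : (1 < p)%N.
Variable a : 'I_p.
Let th : expo r := nexpo (fun k : I =>
   if val k == 0%N then val a else if val k == r then 1%N else 0%N).

Lemma theta_coef (k : I) : th k = (if k == i0 then a%:Z else if k == ir then 1 else 0).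
Proof. by rewrite ffunE -!val_eqE vi0 vir /=; case: ifP => // _; case: ifP. Qed.

Lemma ThetaH_vf : ThetaH F r a =
  vf F p (th - ebase ir) i0 - a%:R *: vf F p (th - ebase i0) ir.
Proof.
rewrite /ThetaH DH_DHz -/th /DHz (bigD1 i0) //= (bigD1 ir) /=; last first.
  by rewrite eq_sym i0_neq_ir.
rewrite big1 ?addr0; last first.
  by move=> i /andP[n1 n2]; rewrite theta_coef (negPf n1) (negPf n2) mulr0 scale0r.
rewrite !theta_coef eqxx eq_sym (negPf i0_neq_ir) eqxx primeI_i0 primeI_ir.
rewrite /sigmaH vi0 vir r_gt0 ltnn mul1r mulr1 scaleN1r opprD opprK addrC.
by rewrite -pmulrn.
Qed.

Variable al : mono p r.
Let A := mexpo al.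
(** The exponent of x_1^(a-1) x^alpha: a Poisson bracket with x_1^a x_(r+1) multiplies by it and
    removes one x_1 and one x_(r+1). *)
Let B := A + th - ebase ir - ebase i0.

Lemma shift_coef k : B k = A k + (if k == i0 then a%:Z - 1 else 0).
Proof.
have -> : B k = A k + th k - ebase ir k - ebase i0 k by rewrite /B !ffunE.
rewrite theta_coef !ffunE; case: eqP => [->|_]; first by rewrite (negPf i0_neq_ir) /=; lia.
by case: eqP => _ /=; lia.
Qed.

Lemma range_thr : inrange p (th - ebase ir).
Proof.
move=> k; have -> : (th - ebase ir) k = th k - ebase ir k by rewrite !ffunE.
rewrite theta_coef ffunE; have := ltn_ord a.
case: eqP => [->|_]; first by rewrite (negPf i0_neq_ir) /=; lia.
by case: eqP => _ /=; lia.
Qed.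

Lemma range_th0 : (0 < a)%N -> inrange p (th - ebase i0).
Proof.
move=> a0 k; have -> : (th - ebase i0) k = th k - ebase i0 k by rewrite !ffunE.
rewrite theta_coef ffunE; have := ltn_ord a; case: eqP => _ /=; first by lia.
by case: eqP => _ /=; lia.
Qed.

(** The summands of D_H(x^alpha) are not just rescaled and shifted: i = i0 has a corrected scalar
    and i = ir produces an additional field along d_(r+1). Only their sum has the form of D_H
    again. *)
Lemma hact_vf i : A i != 0 ->
  hact a (vf F p (A - ebase i) (primeI i)) =
  ((A i0)%:~R - a%:R * (A ir)%:~R + (i == i0)%:R * (a%:R - 1))
     *: vf F p (B - ebase i) (primeI i)
  + ((i == ir)%:R * a%:R * (a%:R - 1)) *: vf F p (B - ebase i0) ir.
Proof.
move=> Ai; rewrite /hact ThetaH_vf.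
have e1 : wbracket (vf F p (th - ebase ir) i0) (vf F p (A - ebase i) (primeI i)) =
   ((A i0)%:~R - (i == i0)%:R - a%:R * (i == ir)%:R) *: vf F p (B - ebase i) (primeI i).
  rewrite wbracket_vf; [|exact: range_thr|exact: inrange_subbase].
  have -> : th - ebase ir + (A - ebase i) - ebase i0 = B - ebase i.
    by rewrite /B; apply: expo_ac1.
  have -> : ((A - ebase i) i0)%:~R = (A i0)%:~R - (i == i0)%:R :> F.
    rewrite [(A - _) i0]ffunE [(- _ : expo r) i0]ffunE [ebase _ _]ffunE rmorphB /=.
    by rewrite eq_sym; case: (i == i0).
  have -> : ((th - ebase ir) (primeI i))%:~R = a%:R * (i == ir)%:R :> F.
    rewrite [(th - _) _]ffunE theta_coef [(- _ : expo r) _]ffunE [ebase _ _]ffunE.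
    rewrite !primeI_eq primeI_i0 primeI_ir rmorphB /=.
    case: (eqVneq i ir) => [->|_].
      by rewrite eq_sym (negPf i0_neq_ir) subr0 mulr1.
    by case: (i == i0); rewrite mulr0 ?subrr ?subr0.
  rewrite [RHS]scalerBl; congr (_ - _).
  case: (eqVneq i ir) => [->|_]; last by rewrite mulr0 !scale0r.
  rewrite primeI_ir; congr (_ *: vf _ _ _ _).
  by rewrite /B; apply: expo_ac1.
have e2 : a%:R *: wbracket (vf F p (th - ebase i0) ir) (vf F p (A - ebase i) (primeI i)) =
   (a%:R * ((A ir)%:~R - (i == ir)%:R - (i == i0)%:R)) *: vf F p (B - ebase i) (primeI i)
   - (a%:R * (a%:R - 1) * (i == ir)%:R) *: vf F p (B - ebase i0) ir.
  (* For a = 0 the exponent [th - ebase i0] is negative at i0, outside the scope of the bracket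
     formula; the prefactor a removes the term. *)
  case: (posnP a) => a0; first by rewrite a0 !mul0r !scale0r subr0.
  rewrite wbracket_vf; [|exact: range_th0|exact: inrange_subbase].
  have -> : th - ebase i0 + (A - ebase i) - ebase ir = B - ebase i.
    by rewrite /B; apply: expo_ac2.
  have -> : ((A - ebase i) ir)%:~R = (A ir)%:~R - (i == ir)%:R :> F.
    rewrite [(A - _) ir]ffunE [(- _ : expo r) ir]ffunE [ebase _ _]ffunE rmorphB /=.
    by rewrite eq_sym; case: (i == ir).
  have -> : ((th - ebase i0) (primeI i))%:~R =
      (a%:R - 1) * (i == ir)%:R + (i == i0)%:R :> F.
    rewrite [(th - _) _]ffunE theta_coef [(- _ : expo r) _]ffunE [ebase _ _]ffunE.
    rewrite !primeI_eq primeI_i0 primeI_ir rmorphB /=.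
    case: (eqVneq i ir) => [->|_].
      by rewrite eq_sym (negPf i0_neq_ir) addr0 mulr1.
    by case: (i == i0); rewrite mulr0 add0r ?subr0 // add0r /= mulr0z oppr0.
  rewrite scalerBr !scalerA; case: (eqVneq i ir) => [->|_].
    rewrite primeI_ir eq_sym (negPf i0_neq_ir) !addr0 subr0 !mulr1.
    have -> // : th - ebase i0 + (A - ebase ir) - ebase i0 = B - ebase i0.
    exact: expo_ac3.
  rewrite !mulr0 add0r scale0r !subr0.
  case: (eqVneq i i0) => [->|_]; last by rewrite mulr0 scale0r !subr0.
  rewrite primeI_i0 mulr1 mulrBr scalerBl mulr1.
  have -> // : th - ebase i0 + (A - ebase i0) - ebase ir = B - ebase i0.
  exact: expo_ac2.
rewrite wbracket_anti linearB linearZ /= opprB !(wbracket_anti (vf _ _ (A - _) _)).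
rewrite scalerN opprK addrC e1 e2 opprB addrCA addrC -scalerBl.
rewrite [X in X + _ = _](_ : _ = ((A i0)%:~R - a%:R * (A ir)%:~R + (i == i0)%:R * (a%:R - 1))
     *: vf F p (B - ebase i) (primeI i)).
  by congr (_ + _ *: _); ring.
by congr (_ *: _); ring.
Qed.

(** With c = alpha_1 - a alpha_(r+1), the corrections at i0 and ir are multiples of the same field
    and add up to (a - 1) c times it. This raises the scalar c alpha_1 to c (alpha_1 + a - 1), the
    one that D_H of the shifted exponent requires. *)
Lemma hact_DHz : hact a (DHm F al) =
  ((A i0)%:~R - a%:R * (A ir)%:~R) *: DHz F p B.
Proof.
rewrite DHm_DHz -/A /DHz linear_sum /=.
pose X i := vf F p (B - ebase i) (primeI i).
pose c : F := (A i0)%:~R - a%:R * (A ir)%:~R.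
transitivity (\sum_(i : I) ((sigmaH F r i * (A i)%:~R * c) *: X i +
   ((i == i0)%:R * ((A i0)%:~R * (a%:R - 1)) *: X i0 -
   (i == ir)%:R * ((A ir)%:~R * a%:R * (a%:R - 1)) *: X i0))).
  (* When alpha_i = 0 the exponent alpha - e_i is out of range, but the summand and its correction
     both carry the factor alpha_i. *)
  apply: eq_bigr => i _; rewrite linearZ /=; have [A0|An] := eqVneq (A i) 0.
    rewrite A0 mulr0z mulr0 mul0r !scale0r.
    have [ei|_] := eqVneq i i0.
      rewrite ei (negPf i0_neq_ir) !mul0r -ei A0 mulr0z.
      by rewrite !mul0r mulr0 !scale0r subr0 addr0.
    have [ei|_] := eqVneq i ir; last by rewrite !mul0r !scale0r subr0 addr0.
    by rewrite -ei A0 mulr0z !mul0r mulr0 !scale0r subr0 addr0.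
  rewrite hact_vf // -/c scalerDr !scalerA -/(X i).
  have -> : vf F p (B - ebase i0) ir = X i0 by rewrite /X primeI_i0.
  have [->|_] := eqVneq i i0.
    rewrite (negPf i0_neq_ir) /sigmaH vi0 r_gt0 !mul0r mulr0 !scale0r subr0 addr0.
    by rewrite -scalerDl; congr (_ *: _); ring.
  have [->|_] := eqVneq i ir.
    rewrite /sigmaH vir ltnn !mul0r scale0r sub0r -scaleNr addr0.
    by congr (_ + _ *: _); ring.
  by rewrite !mul0r mulr0 !scale0r subr0 !addr0.
rewrite big_split /= sumrB.
have pick (j : I) (x : F) (y : W) : \sum_(i : I) (i == j)%:R * x *: y = x *: y.
  rewrite (bigD1 j) //= big1 ?addr0 ?eqxx ?mul1r // => i /negPf ->.
  by rewrite mul0r scale0r.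
rewrite !pick -scalerBl scaler_sumr [in RHS](bigD1 i0) // [in LHS](bigD1 i0) //=.
rewrite addrAC -scalerDl; congr (_ + _).
  rewrite scalerA -/(X i0); congr (_ *: _).
  rewrite shift_coef eqxx /sigmaH vi0 r_gt0 rmorphD rmorphB /= -pmulrn /c; ring.
apply: eq_bigr => i ni; rewrite scalerA; congr (_ *: _).
by rewrite shift_coef (negPf ni) addr0 mulrC.
Qed.

Definition setx (l : 'I_p) : mono p r := [ffun k => if k == i0 then l else al k].

Lemma hact_DHm : p \in [pchar F] -> hact a (DHm F al) =
  \sum_(l < p) (if (al i0 + a == l + 1)%N then (al i0)%:R - (a * al ir)%:R else 0)
     *: DHm F (setx l).
Proof.
move=> hchar; rewrite hact_DHz.
have -> : (A i0)%:~R - a%:R * (A ir)%:~R = (al i0)%:R - (a * al ir)%:R :> F.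
  by rewrite natrM !ffunE -!pmulrn.
case: (posnP (al i0 + a)) => [z|nz].
  rewrite big1 => [|l _]; last by case: eqP => [|_]; rewrite ?scale0r //; lia.
  have -> : (al i0 : nat) = 0%N by lia.
  have -> : (a : nat) = 0%N by lia.
  by rewrite mul0n subrr scale0r.
have [lp|pl] := ltnP (al i0 + a).-1 p.
  rewrite (bigD1 (Ordinal lp)) //= big1 ?addr0 => [|l nl]; last first.
    by case: eqP => [?|_]; rewrite ?scale0r //; move: nl; rewrite -val_eqE /=; lia.
  have -> : (al i0 + a == (al i0 + a).-1 + 1)%N by lia.
  rewrite DHm_DHz; congr (_ *: DHz _ _ _); apply/ffunP => k.
  rewrite shift_coef !ffunE; case: eqP => [->|_] /=; lia.
rewrite big1 => [|l _]; last first.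
  by case: eqP => [?|_]; rewrite ?scale0r //; have := ltn_ord l; lia.
(* Overflow in x_1: components with i <> i0 leave the range. If the new exponent is exactly p, the
   component i0 has x_1-exponent p - 1 and survives as a monomial, but its coefficient is p = 0. *)
have B0 : B i0 = ((al i0 + a).-1)%:Z by rewrite shift_coef eqxx ffunE /=; lia.
rewrite /DHz big1 ?scaler0 // => i _.
have [ei|ni] := eqVneq i i0; last first.
  rewrite vf_notin ?scaler0 // => /(_ i0).
  rewrite [(B - _) i0]ffunE [(- _ : expo r) i0]ffunE [ebase _ _]ffunE.
  by rewrite B0 eq_sym (negPf ni) /=; lia.
have [ep|np] := eqVneq (al i0 + a).-1 p.
  by rewrite ei B0 ep -pmulrn (pcharf0 hchar) mulr0 scale0r.
rewrite vf_notin ?scaler0 // => /(_ i0).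
by rewrite [(B - _) i0]ffunE [(- _ : expo r) i0]ffunE [ebase _ _]ffunE B0 ei eqxx /=; lia.
Qed.

End Action.

(** * Linear families and subquotients of stable subspaces *)

Section OrdFamilies.
Variables (F : fieldType) (vT : vectType F) (n : nat) (b : 'I_n -> vT).

Lemma span_ordP x :
  reflect (exists c : 'I_n -> F, x = \sum_k c k *: b k)
    (x \in <<[seq b k | k : 'I_n]>>%VS).
Proof.
change (reflect (exists c : 'I_n -> F, x = \sum_k c k *: b k)
  (x \in <<mktuple b>>%VS)).
apply: (iffP idP) => [/coord_span e|[c ->]].
  exists (fun k => coord (mktuple b) k x); rewrite {1}e.
  by apply: eq_bigr => k _; rewrite nth_mktuple.
apply: memv_suml => k _; apply: memvZ; apply: memv_span.
by apply/mapP; exists k; rewrite ?mem_enum.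
Qed.

Lemma free_ordP :
  reflect (forall c : 'I_n -> F, \sum_k c k *: b k = 0 -> forall k, c k = 0)
    (free [seq b k | k : 'I_n]).
Proof.
change (reflect (forall c : 'I_n -> F, \sum_k c k *: b k = 0 -> forall k, c k = 0)
  (free (mktuple b))).
have e (c : 'I_n -> F) : \sum_k c k *: (mktuple b)`_k = \sum_k c k *: b k.
  by apply: eq_bigr => k _; rewrite nth_mktuple.
by apply: (iffP freeP) => h c hc; apply: h; rewrite ?e // -e.
Qed.
End OrdFamilies.

Section Quotients.
Variables (F : fieldType) (p r : nat).
Local Notation W := (Wt F p r).
Implicit Types (U A B X : {vspace W}) (M N : wmod F p).

Lemma quot_iso_wiso A U M N :
  wiso (wact N) (wact M) -> quot_iso A U M -> quot_iso A U N.
Proof.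
case=> g [homg gfree gfull] [b [fb dir eqU act]].
have nm : wdim N = wdim M by rewrite -(eqP gfree) (eqP gfull).
case/row_fullP: gfull => h hg.
pose b' k := \sum_l g k l *: b l.
have eqB : <<[seq b' k | k : 'I_(wdim N)]>>%VS = <<[seq b k | k : 'I_(wdim M)]>>%VS.
  apply/vspaceP => x; apply/span_ordP/span_ordP => -[c ->].
    exists (fun l => \sum_k c k * g k l).
    under eq_bigr => k _ do rewrite scaler_sumr.
    rewrite exchange_big /=; apply: eq_bigr => l _; rewrite scaler_suml.
    by apply: eq_bigr => k _; rewrite scalerA.
  exists (fun k => \sum_l c l * h l k).
  under [RHS]eq_bigr => k _ do rewrite scaler_suml.
  rewrite exchange_big /=; apply: eq_bigr => l _.
  under eq_bigr => k _ do rewrite -scalerA.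
  rewrite -scaler_sumr; congr (_ *: _).
  under eq_bigr => k _ do rewrite scaler_sumr.
  rewrite exchange_big /=.
  transitivity (\sum_j (1%:M : 'M[F]_(wdim M)) l j *: b j).
    rewrite (bigD1 l) //= mxE eqxx scale1r big1 ?addr0 // => j nj.
    by rewrite mxE eq_sym (negPf nj) scale0r.
  apply: eq_bigr => j _; rewrite -hg mxE scaler_suml.
  by apply: eq_bigr => k _; rewrite scalerA.
exists b'; split.
- move: fb; rewrite /free eqB => /eqP ->.
  by rewrite !size_map -!enumT !size_enum_ord nm.
- by rewrite eqB.
- by rewrite eqB.
- move=> a k.
  have -> : hact a (b' k) - \sum_l wact N a k l *: b' l =
     \sum_l g k l *: (hact a (b l) - \sum_t wact M a l t *: b t).
    under [RHS]eq_bigr => l _ do rewrite scalerBr.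
    rewrite sumrB linear_sum /=; congr (_ - _).
      by apply: eq_bigr => l _; rewrite linearZ.
    have lhs (m : nat) (P : 'M[F]_(wdim N, m)) (Q : 'M[F]_(m, wdim M)) :
      \sum_l P k l *: (\sum_t Q l t *: b t) = \sum_t (P *m Q) k t *: b t.
      under eq_bigr => l _ do rewrite scaler_sumr.
      rewrite exchange_big /=; apply: eq_bigr => t _.
      by rewrite mxE scaler_suml; apply: eq_bigr => l _; rewrite scalerA.
    by rewrite !lhs homg.
  by apply: memv_suml => l _; apply: memvZ.
Qed.

Lemma quot_iso_cat (s : seq W) n (rho : 'I_p -> 'M[F]_n) (b : 'I_n -> W) :
  free (s ++ [seq b k | k : 'I_n]) ->
  (forall a k, hact a (b k) - \sum_l rho a k l *: b l \in <<s>>%VS) ->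
  quot_iso <<s>>%VS <<s ++ [seq b k | k : 'I_n]>>%VS (WMod rho).
Proof.
rewrite cat_free => /and3P[_ fb dir] act; exists b; split=> //.
by rewrite span_cat.
Qed.

Lemma quot_iso_sub U M : quot_iso 0%VS U M -> sub_iso U M.
Proof.
case=> b [fb _]; rewrite add0v => eqU act; exists b; split.
  by rewrite /basis_of eqU eqxx.
by move=> a k; have := act a k; rewrite memv0 subr_eq0 => /eqP.
Qed.

Lemma quot_isoP A U M (b : 'I_(wdim M) -> W) x :
  (A + <<[seq b k | k : 'I_(wdim M)]>>)%VS = U -> x \in U ->
  exists2 u, u \in A & exists c : 'I_(wdim M) -> F, x = u + \sum_k c k *: b k.
Proof.
by move=> <- /memv_addP[u uA [v /span_ordP[c ->] e]]; exists u => //; exists c.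
Qed.

Lemma hact_comb A M (b : 'I_(wdim M) -> W) (c : 'I_(wdim M) -> F) a :
  (forall k, hact a (b k) - \sum_l wact M a k l *: b l \in A) ->
  hact a (\sum_k c k *: b k) -
    \sum_l (\sum_k c k * wact M a k l) *: b l \in A.
Proof.
move=> act; have -> : hact a (\sum_k c k *: b k) -
    \sum_l (\sum_k c k * wact M a k l) *: b l =
    \sum_k c k *: (hact a (b k) - \sum_l wact M a k l *: b l).
  under [RHS]eq_bigr => k _ do rewrite scalerBr.
  rewrite sumrB linear_sum /=; congr (_ - _).
    by apply: eq_bigr => k _; rewrite linearZ.
  under [RHS]eq_bigr => k _ do rewrite scaler_sumr.
  rewrite exchange_big /=; apply: eq_bigr => l _.
  by rewrite scaler_suml; apply: eq_bigr => k _; rewrite scalerA.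
by apply: memv_suml => k _; apply: memvZ.
Qed.

Lemma quot_iso_stable A U M : stable A -> quot_iso A U M -> stable U.
Proof.
move=> stA [b [fb dir eqU act]] a x xU.
have [u uA [c ->]] := quot_isoP eqU xU; rewrite linearD /= -eqU.
apply: rpredD.
  by apply: subvP (addvSl _ _) _ _; apply: stA.
rewrite -[hact _ _](subrK (\sum_l (\sum_k c k * wact M a k l) *: b l)).
apply: memv_add; first exact: (hact_comb c (act a)).
by apply/span_ordP; exists (fun l => \sum_k c k * wact M a k l).
Qed.

Lemma quot_iso_le A U M : quot_iso A U M -> (A <= U)%VS.
Proof. by case=> b [_ _ <- _]; apply: addvSl. Qed.

Lemma quot_iso_addl B A U M : (B :&: U)%VS = 0%VS ->
  quot_iso A U M -> quot_iso (B + A)%VS (B + U)%VS M.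
Proof.
move=> BU [b [fb dir eqU act]]; exists b; split=> //.
- apply/directv_addP/eqP; rewrite -subv0; apply/subvP => x.
  rewrite memv_cap => /andP[/memv_addP[w wB [u uA e]] xb].
  have xU : x \in U by rewrite -eqU; apply: subvP (addvSr _ _) _ xb.
  have uU : u \in U by rewrite -eqU; apply: subvP (addvSl _ _) _ uA.
  have w0 : w = 0.
    apply/eqP; rewrite -memv0 -BU memv_cap wB /=.
    by rewrite -(addrK u w) -e rpredB.
  move: dir => /directv_addP <-; rewrite memv_cap xb andbT.
  by rewrite e w0 add0r.
- by rewrite -addvA eqU.
- by move=> a k; apply: subvP (addvSr _ _) _ (act a k).
Qed.

(** In the coordinates given by the basis b of U/A, the subspace X becomes the space K of rows c
    with sum c_k b_k in X. Stability of X makes K a submodule of M, so K is zero or everything. *)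
Lemma quot_iso_simple A U M X : quot_iso A U M -> is_simple (wact M) ->
  stable X -> (A <= X)%VS -> (X <= U)%VS -> X = A \/ X = U.
Proof.
move=> [b [fb dir eqU act]] [_ simp] stX AX XU.
(* [pr] vanishes exactly on X, which presents K as the kernel of a matrix. *)
pose pr (x : W) : W := x - projv X x.
pose T := ('I_(2 * r) * mono p r)%type.
pose Bm : 'M[F]_(wdim M, #|{: T}|) := \matrix_(k, t) pr (b k) (enum_val t).
pose K := kermx Bm.
have KP (c : 'rV_(wdim M)) : (c <= K)%MS = (\sum_k c 0 k *: b k \in X).
  set y := \sum_k _.
  have ye : pr y = \sum_k c 0 k *: pr (b k).
    rewrite /pr /y linear_sum -sumrB; apply: eq_bigr => k _.
    by rewrite linearZ scalerBr.
  have cB t : (c *m Bm) 0 t = pr y (enum_val t).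
    rewrite [LHS]mxE ye sum_ffunE; apply: eq_bigr => k _.
    by rewrite [Bm _ _]mxE [RHS]ffunE.
  apply/sub_kermxP/idP => [cB0|yX].
    suff /eqP : pr y = 0 by rewrite subr_eq0 => /eqP ->; apply: memv_proj.
    apply/ffunP => t; have := cB (enum_rank t).
    by rewrite cB0 mxE enum_rankK => <-; rewrite ffunE.
  by apply/rowP => t; rewrite cB /pr projv_id // subrr !mxE ffunE.
have stK a : stablemx K (wact M a).
  apply/rV_subP => d /submxP[e ->]; rewrite mulmxA.
  have : (e *m K <= K)%MS by apply: submxMl.
  move: (e *m K) => c; rewrite !KP => cX.
  have := hact_comb (fun k => c 0 k) (act a) => /(subvP AX) h.
  have := rpredB (stX a _ cX) h; rewrite opprB addrCA subrr addr0.
  have -> // : \sum_l (\sum_k c 0 k * wact M a k l) *: b l =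
    \sum_k (c *m wact M a) 0 k *: b k.
  by apply: eq_bigr => l _; rewrite mxE.
have /orP[K0|Kf] := simp K stK.
  left; apply/eqP; rewrite eqEsubv AX andbT; apply/subvP => x xX.
  have [u uA [c e]] := quot_isoP eqU (subvP XU _ xX).
  have : (\row_k c k <= K)%MS.
    rewrite KP.
    have -> : \sum_k (\row_k c k) 0 k *: b k = x - u.
      by rewrite e addrC addKr; apply: eq_bigr => k _; rewrite mxE.
    by rewrite rpredB // (subvP AX).
  move: K0; rewrite mxrank_eq0 => /eqP ->; rewrite submx0 => /eqP c0.
  rewrite e rpredD // big1 ?rpred0 // => k _.
  by have /rowP/(_ k) := c0; rewrite !mxE => ->; rewrite scale0r.
right; apply/eqP; rewrite eqEsubv XU /=; rewrite -eqU subv_add AX /=.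
apply/subvP => x /span_ordP[c ->].
have := submx_full (\row_k c k) Kf; rewrite KP.
have -> // : \sum_k (\row_k c k) 0 k *: b k = \sum_k c k *: b k.
by apply: eq_bigr => l _; rewrite mxE.
Qed.
End Quotients.

(** * The Jordan-Hoelder theorem for chains of stable subspaces *)

Section JordanHolder.
Variables (F : fieldType) (p r : nat).
Local Notation W := (Wt F p r).
Implicit Types (U A B X : {vspace W}) (M N : wmod F p) (s t : nat -> {vspace W}).

Lemma stable_cap A B : stable A -> stable B -> stable (A :&: B)%VS.
Proof.
move=> sA sB a x; rewrite !memv_cap => /andP[xA xB].
by rewrite sA // sB.
Qed.

Lemma stable_add A B : stable A -> stable B -> stable (A + B)%VS.
Proof.
move=> sA sB a x /memv_addP[u uA [v vB ->]].
by rewrite linearD /= memv_add // ?sA ?sB.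
Qed.

Definition comp_chain s n : Prop :=
  [/\ s 0%N = 0%VS, forall i, (i <= n)%N -> stable (s i) &
   forall i, (i < n)%N -> [/\ (s i <= s i.+1)%VS, s i != s i.+1 &
     forall X, stable X -> (s i <= X)%VS -> (X <= s i.+1)%VS ->
       X = s i \/ X = s i.+1]].

Lemma comp_chain_le s n i j : comp_chain s n -> (i <= j <= n)%N -> (s i <= s j)%VS.
Proof.
move=> [_ _ st] /andP[]; elim: j => [|j IH]; first by rewrite leqn0 => /eqP ->.
rewrite leq_eqVlt => /orP[/eqP -> //|ij] jn.
by apply: subv_trans (IH ij (ltnW jn)) _; case: (st _ jn).
Qed.

(** The pairing of steps from the Schreier-Zassenhaus argument: k is where the trace of t on s_(i+1)
    first leaves s_i. *)
Definition jump s t i k :=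
  ((s i.+1 :&: t k <= s i) && ~~ (s i.+1 :&: t k.+1 <= s i))%VS.

Section TwoChains.
Variables (s t : nat -> {vspace W}) (n m : nat).
Hypotheses (cs : comp_chain s n) (ct : comp_chain t m).

Lemma jump_exists i : s n = t m -> (i < n)%N ->
  exists2 k, (k < m)%N & jump s t i k.
Proof.
move=> e ni; have [_ _ /(_ _ ni)[le ne _]] := cs.
have ex : exists k, ~~ (s i.+1 :&: t k <= s i)%VS.
  exists m; have /capv_idPl -> : (s i.+1 <= t m)%VS.
    by rewrite -e; apply: (comp_chain_le cs); rewrite ni leqnn.
  by apply: contra ne => le'; rewrite eqEsubv le le'.
have [|km] := leqP (ex_minn ex) m; last first.
  move: km; case: ex_minnP => k _ mn km; exfalso.
  have := mn m; rewrite leqNgt km /= => h; apply/notF/h.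
  have /capv_idPl -> : (s i.+1 <= t m)%VS.
    by rewrite -e; apply: (comp_chain_le cs); rewrite ni leqnn.
  by apply: contra ne => le'; rewrite eqEsubv le le'.
case: ex_minnP => -[|k] hk mn km.
  by move: hk; case: ct => -> _ _; rewrite capv0 sub0v.
exists k => //; rewrite /jump hk andbT; apply/negPn/negP => /mn.
by rewrite ltnn.
Qed.

Lemma jump_le i k k' : (k' < m)%N -> jump s t i k -> jump s t i k' -> (k' <= k)%N.
Proof.
move=> km /andP[_ h1] /andP[h2 _]; rewrite leqNgt; apply: contra h1 => kk.
apply: subv_trans h2; apply: capvS => //.
by apply: (comp_chain_le ct); rewrite kk ltnW.
Qed.

(* If [t k + (t k.+1 :&: s i)] were all of [t k.+1], the part of [s i.+1] lying
   in [t k.+1] would already be in [s i + (t k :&: s i.+1) = s i]. *)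
Lemma jump_sym i k : (i < n)%N -> (k < m)%N -> jump s t i k -> jump t s k i.
Proof.
move=> ni km /andP[h1 h2].
have [_ sts /(_ _ ni)[les _ _]] := cs; have [_ stt /(_ _ km)[let_ net simt]] := ct.
apply/andP; split; last first.
  apply: contra h2 => h; apply: subv_trans h1; rewrite subv_cap capvSl /=.
  by rewrite capvC.
have [|||e|e] := simt (t k + (t k.+1 :&: s i))%VS.
- by apply: stable_add; [apply: stt | apply: stable_cap; [apply: stt | apply: sts]]; lia.
- exact: addvSl.
- by rewrite subv_add let_ capvSl.
- by rewrite -e addvSr.
case/negP: h2; apply/subvP => z; rewrite memv_cap => /andP[zs zt].
move: zt; rewrite -e => /memv_addP[u ut [w]].
rewrite memv_cap => /andP[wt ws] ez.
rewrite ez rpredD //; apply: (subvP h1); rewrite memv_cap ut andbT.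
by rewrite -(addrK w u) -ez rpredB // (subvP les).
Qed.

Lemma jump_add i k : (i < n)%N -> (k < m)%N -> jump s t i k ->
  (s i + (s i.+1 :&: t k.+1))%VS = s i.+1.
Proof.
move=> ni km /andP[h1 h2].
have [_ sts /(_ _ ni)[les _ sims]] := cs; have [_ stt _] := ct.
have [|||e|//] := sims (s i + (s i.+1 :&: t k.+1))%VS.
- by apply: stable_add; [apply: sts | apply: stable_cap; [apply: sts | apply: stt]]; lia.
- exact: addvSl.
- by rewrite subv_add les capvSl.
by case/negP: h2; rewrite -e addvSr.
Qed.
End TwoChains.

(** Both quotients are realised on s_(i+1) :&: t_(k+1): it covers t_(k+1) modulo t_k and s_(i+1)
    modulo s_i, and on it membership in t_k and in s_i coincide. So the representatives b of
    t_(k+1)/t_k can be replaced by vectors b' in the intersection. *)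
Lemma jump_iso s t n m i k M : comp_chain s n -> comp_chain t m ->
  (i < n)%N -> (k < m)%N -> jump s t i k ->
  quot_iso (t k) (t k.+1) M -> quot_iso (s i) (s i.+1) M.
Proof.
move=> cs ct ni km J; have J' := jump_sym cs ct ni km J.
have es := jump_add cs ct ni km J; have et := jump_add ct cs km ni J'.
have /andP[st0 _] := J; have /andP[ts0 _] := J'.
have [_ sts /(_ _ ni)[les _ _]] := cs.
move=> [b [fb dir eqU act]].
have ex (l : 'I_(wdim M)) : exists b' : W,
    (b' \in (t k.+1 :&: s i.+1)%VS) && (b l - b' \in t k).
  have : b l \in t k.+1.
    rewrite -eqU; apply: subvP (addvSr _ _) _ _; apply: memv_span.
    by apply/mapP; exists l; rewrite ?mem_enum.
  rewrite -{1}et => /memv_addP[u ut [w wc ->]]; exists w.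
  by rewrite wc addrK.
have [b' hb'] := fin_all_exists ex.
have b's l : b' l \in s i.+1 by have := hb' l; rewrite memv_cap -andbA => /and3P[].
have b't l : b' l \in t k.+1 by have := hb' l; rewrite memv_cap -andbA => /and3P[].
have bb l : b l - b' l \in t k by have := hb' l => /andP[].
have diff (c : 'I_(wdim M) -> F) :
    \sum_l c l *: b l - \sum_l c l *: b' l \in t k.
  rewrite -sumrB; apply: rpred_sum => l _; rewrite -scalerBr.
  exact: rpredZ.
have indep (c : 'I_(wdim M) -> F) : \sum_l c l *: b' l \in t k -> forall l, c l = 0.
  move=> h; move/free_ordP: fb; apply; apply/eqP.
  have bt : \sum_l c l *: b l \in t k.
    by rewrite -(subrK (\sum_l c l *: b' l) (\sum_l _)) rpredD.
  rewrite -memv0; move/directv_addP: dir => <-; rewrite memv_cap bt.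
  by apply/span_ordP; exists c.
exists b'; split.
- by apply/free_ordP => c hc; apply: indep; rewrite hc mem0v.
- apply/directv_addP/eqP; rewrite -subv0; apply/subvP => x.
  rewrite memv_cap => /andP[xs /span_ordP[c e]].
  have xt : x \in t k.
    apply: (subvP ts0); rewrite memv_cap xs andbT e.
    by apply: memv_suml => l _; apply: memvZ; apply: b't.
  rewrite e big1 ?mem0v // => l _; rewrite indep ?scale0r // -e //.
- apply/eqP; rewrite eqEsubv subv_add les /=; apply/andP; split.
    by apply/subvP => x /span_ordP[c ->]; apply: memv_suml => l _; apply: memvZ; apply: b's.
  rewrite -es subv_add addvSl /=; apply/subvP => x.
  rewrite memv_cap => /andP[xs xt].
  have [u ut [c e]] := quot_isoP eqU xt.
  have ex' : x = (u + (\sum_l c l *: b l - \sum_l c l *: b' l)) + \sum_l c l *: b' l.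
    by rewrite -addrA subrK.
  rewrite ex' memv_add //; last by apply/span_ordP; exists c.
  apply: (subvP st0); rewrite memv_cap; apply/andP; split; last first.
    by apply: memvD => //; apply: diff.
  have -> : u + (\sum_l c l *: b l - \sum_l c l *: b' l) = x - \sum_l c l *: b' l.
    by rewrite e addrA.
  by rewrite rpredB //; apply: memv_suml => l _; apply: memvZ; apply: b's.
- move=> a l; apply: (subvP st0); rewrite memv_cap; apply/andP; split.
    rewrite rpredB //; first by apply: sts.
    by apply: memv_suml => j _; apply: memvZ; apply: b's.
  have [_ stt _] := ct; have stk : stable (t k) by apply: stt; lia.
  have -> : hact a (b' l) - \sum_j wact M a l j *: b' j =
    (hact a (b l) - \sum_j wact M a l j *: b j) - hact a (b l - b' l)
    + (\sum_j wact M a l j *: b j - \sum_j wact M a l j *: b' j).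
    rewrite linearB /= opprB [X in _ = X + _]addrC.
    by rewrite !addrA !subrK.
  apply: rpredD; last exact: diff.
  by apply: rpredB; [apply: act | apply: stk].
Qed.

Variable L : nat -> wmod F p.

(** Labels run from the bottom up. The intermediate subspaces are existential, so that filtrations
    concatenate easily; [filt_chain] recovers them as a function. *)
Fixpoint filt A (l : seq nat) U : Prop :=
  if l is x :: l' then exists2 A', quot_iso A A' (L x) & filt A' l' U else A = U.

Lemma filt_cat A B U l1 l2 : filt A l1 B -> filt B l2 U -> filt A (l1 ++ l2) U.
Proof.
elim: l1 A => [|x l IH] A /=; first by move=> ->.
by case=> A' q f1 f2; exists A' => //; apply: IH.
Qed.

Lemma filt_le A l U : filt A l U -> (A <= U)%VS.
Proof.
elim: l A => [|x l IH] A /=; first by move=> ->.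
by case=> A' q /IH; apply: subv_trans (quot_iso_le q).
Qed.

Lemma filt_addl B A l U : (B :&: U)%VS = 0%VS -> filt A l U ->
  filt (B + A)%VS l (B + U)%VS.
Proof.
move=> BU; elim: l A => [|x l IH] A /=; first by move=> ->.
case=> A' q f; exists (B + A')%VS; last exact: IH.
apply: quot_iso_addl q; apply/eqP; rewrite -subv0 -BU capvS //.
exact: filt_le f.
Qed.

Lemma filt_chain A l U : filt A l U -> exists t : nat -> {vspace W},
  [/\ t 0%N = A, t (size l) = U &
   forall k, (k < size l)%N -> quot_iso (t k) (t k.+1) (L (nth 0%N l k))].
Proof.
elim: l A => [|x l IH] A /=; first by move=> ->; exists (fun _ => U).
case=> A' q /IH[t [t0 tl th]].
exists (fun k => if k is k'.+1 then t k' else A); split=> // -[|k] /= kl.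
  by rewrite t0.
exact: th.
Qed.

Lemma stable0 : stable (0%VS : {vspace W}).
Proof. by move=> a w; rewrite memv0 => /eqP ->; rewrite linear0 mem0v. Qed.

Lemma quot_iso_proper A U M : (0 < wdim M)%N -> quot_iso A U M -> A != U.
Proof.
move=> d0 [b [fb dir eqU _]]; apply/negP => /eqP e.
have bin : b (Ordinal d0) \in [seq b k | k : 'I_(wdim M)].
  by apply/mapP; exists (Ordinal d0); rewrite ?mem_enum.
have bA : b (Ordinal d0) \in A.
  by rewrite e -eqU; apply: subvP (addvSr _ _) _ _; apply: memv_span.
have : b (Ordinal d0) \in 0%VS.
  by move/directv_addP: dir => <-; rewrite memv_cap bA /=; apply: memv_span.
by rewrite memv0 => /eqP b0; have := free_not0 fb bin; rewrite b0 eqxx.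
Qed.

(** Every step of one chain jumps at a unique step of the other, and [jump] is symmetric, so f and g
    are inverse bijections. Step i of the given series inherits the label of step f i of the known
    filtration. *)
Lemma jordan_holder U l (ss : seq {vspace W}) :
  (forall x, x \in l -> is_simple (wact (L x))) ->
  filt 0%VS l U -> comp_series U ss ->
  exists lab : 'I_(size ss).-1 -> nat,
    (forall i, lab i \in l /\
       quot_iso (nth 0%VS ss i) (nth 0%VS ss i.+1) (L (lab i))) /\
    forall j, #|[set i | lab i == j]| = count_mem j l.
Proof.
move=> simp /filt_chain[t [t0 tl tq]] [sz s0 sl sst sstep].
set n := (size ss).-1; pose s i := nth 0%VS ss i; pose m := size l.
have sn : size ss = n.+1 by rewrite /n prednK.
have cs : comp_chain s n.
  split=> // [i ni|i ni]; first by apply: sst; rewrite sn.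
  by apply: sstep; rewrite sn.
have tst k : (k <= m)%N -> stable (t k).
  elim: k => [|k IH] km; first by rewrite t0; apply: stable0.
  by apply: quot_iso_stable (tq _ km); apply: IH; apply: ltnW.
have ct : comp_chain t m.
  split=> // k km; have q := tq k km.
  have sk := simp _ (mem_nth 0%N km); split; first exact: quot_iso_le q.
    by apply: quot_iso_proper q; case: sk.
  by move=> X; apply: quot_iso_simple q sk.
have e : s n = t m by rewrite tl -sl /s /n nth_last.
have ex1 (i : 'I_n) : exists k : 'I_m, jump s t i k.
  by have [k km J] := jump_exists cs ct e (ltn_ord i); exists (Ordinal km).
have ex2 (k : 'I_m) : exists i : 'I_n, jump t s k i.
  by have [i ni J] := jump_exists ct cs (esym e) (ltn_ord k); exists (Ordinal ni).
have [f hf] := fin_all_exists ex1; have [g hg] := fin_all_exists ex2.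
have fK : cancel f g.
  move=> i; apply/val_inj/eqP; have J := jump_sym cs ct (ltn_ord _) (ltn_ord _) (hf i).
  by rewrite eqn_leq !(jump_le cs (ltn_ord _) _ J) ?(jump_le cs (ltn_ord _) J) // hg.
have gK : cancel g f.
  move=> i; apply/val_inj/eqP; have J := jump_sym ct cs (ltn_ord _) (ltn_ord _) (hg i).
  by rewrite eqn_leq !(jump_le ct (ltn_ord _) _ J) ?(jump_le ct (ltn_ord _) J) // hf.
exists (fun i => nth 0%N l (f i)); split.
  move=> i; split; first exact: mem_nth.
  exact: (jump_iso cs ct (ltn_ord _) (ltn_ord _) (hf i) (tq _ (ltn_ord _))).
move=> j; have -> : [set i | nth 0%N l (f i) == j] = g @: [set k : 'I_m | nth 0%N l k == j].
  apply/setP => i; rewrite inE; apply/idP/imsetP => [h|[k]].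
    by exists (f i); rewrite ?inE ?fK.
  by rewrite inE => h ->; rewrite gK.
rewrite card_imset; last exact: can_inj gK.
by rewrite -sum1dep_card -sum1_count (big_nth 0%N) big_mkord.
Qed.
End JordanHolder.

(** * Concatenated lists and direct sums of filtrations *)

Lemma ord0_neq_max n : (2 < n.+1)%N -> (ord0 == ord_max :> 'I_n.+1) = false.
Proof. by move=> n2; apply/eqP => /(congr1 val) /=; lia. Qed.

Lemma map_nseq_in (S : eqType) (T : Type) (f : S -> T) s x :
  {in s, forall y, f y = x} -> map f s = nseq (size s) x.
Proof.
elim: s => //= y s IH h; rewrite h ?mem_head // IH // => z zs.
by apply: h; rewrite inE zs orbT.
Qed.

Lemma uniq_flatten_key (S T : eqType) (f : S -> seq T) (key : T -> S) s :
  uniq s -> {in s, forall c, uniq (f c)} ->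
  {in s, forall c x, x \in f c -> key x = c} -> uniq (flatten (map f s)).
Proof.
elim: s => //= c s IH /andP[cs us] uf kf; rewrite cat_uniq uf ?mem_head //=.
rewrite IH //; last first.
- by move=> d ds; apply: kf; rewrite inE ds orbT.
- by move=> d ds; apply: uf; rewrite inE ds orbT.
rewrite andbT; apply/hasPn => x /flatten_mapP[d ds xd]; apply/negP => xc.
by move: cs; rewrite -(kf c _ x xc) ?mem_head // (kf d _ x xd) ?ds // inE ds orbT.
Qed.

Lemma span_flatten (K : fieldType) (vT : vectType K) (ss : seq (seq vT)) :
  <<flatten ss>>%VS = (\sum_(x <- ss) <<x>>)%VS.
Proof.
elim: ss => [|x ss IH] /=; first by rewrite big_nil span_nil.
by rewrite big_cons span_cat IH.
Qed.

Lemma dim_span_flatten (K : fieldType) (vT : vectType K) (ss : seq (seq vT)) :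
  free (flatten ss) -> (\sum_(x <- ss) \dim <<x>> = \dim <<flatten ss>>)%N.
Proof.
elim: ss => [|x ss IH] /=; first by rewrite big_nil span_nil dimv0.
move=> fr; have := fr; rewrite cat_free => /and3P[fx fs _].
by rewrite big_cons IH // (eqP fr) (eqP fx) size_cat (eqP fs).
Qed.

Lemma filt_flatten (F : fieldType) (p r : nat) (L : nat -> wmod F p) (S : eqType)
    (f : S -> seq (Wt F p r)) (lb : S -> seq nat) s :
  free (flatten (map f s)) ->
  {in s, forall c, filt L 0%VS (lb c) <<f c>>%VS} ->
  filt L 0%VS (flatten (map lb s)) <<flatten (map f s)>>%VS.
Proof.
elim: s => [|c s IH] /=; first by rewrite span_nil.
rewrite cat_free => /and3P[_ fs dir] h; rewrite span_cat.
apply: (filt_cat (h c (mem_head _ _))).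
rewrite -{1}[<<f c>>%VS]addv0; apply: filt_addl; first exact/directv_addP.
by apply: IH => // d ds; apply: h; rewrite inE ds orbT.
Qed.

(** * Partition of the monomials into rows *)

Section Monomials.
Variables (q r : nat).
Local Notation p := q.+1.
Local Notation I := 'I_(2 * r).
Variables (i0 ir : I).
Hypotheses (vi0 : val i0 = 0%N) (vir : val ir = r).

(* x^l y^j m, where x and y are the variables of index [i0] and [ir]. *)
Definition row_mono (l j : 'I_p) (m : mono p r) : mono p r :=
  [ffun k => if k == i0 then l else if k == ir then j else m k].

Definition rest (al : mono p r) : mono p r :=
  [ffun k => if (k == i0) || (k == ir) then ord0 else al k].

Definition restset := [set m : mono p r | (m i0 == ord0) && (m ir == ord0)].
Definition mzero : mono p r := [ffun=> ord0].
Definition mtop : mono p r :=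
  [ffun k => if (k == i0) || (k == ir) then ord0 else ord_max].

Lemma ir_neq_i0 : (ir == i0) = false.
Proof. by apply/negbTE; rewrite eq_sym; apply: i0_neq_ir vi0 vir. Qed.

Lemma row_mono_i0 l j m : row_mono l j m i0 = l.
Proof. by rewrite ffunE eqxx. Qed.

Lemma row_mono_ir l j m : row_mono l j m ir = j.
Proof. by rewrite ffunE ir_neq_i0 eqxx. Qed.

Lemma rest_row_mono l j m : m \in restset -> rest (row_mono l j m) = m.
Proof.
rewrite inE => /andP[/eqP m0 /eqP mr]; apply/ffunP => k; rewrite !ffunE.
by case: eqP => [->|] //=; case: eqP => [->|].
Qed.

Lemma row_mono_rest (al : mono p r) : row_mono (al i0) (al ir) (rest al) = al.
Proof.
apply/ffunP => k; rewrite !ffunE.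
by case: eqP => [->|] //=; case: eqP => [->|].
Qed.

Lemma rest_in (al : mono p r) : rest al \in restset.
Proof. by rewrite inE !ffunE !eqxx orbT. Qed.

Lemma mzero_in : mzero \in restset.
Proof. by rewrite inE !ffunE. Qed.

Lemma mtop_in : mtop \in restset.
Proof. by rewrite inE !ffunE !eqxx orbT. Qed.

Lemma card_restset : #|restset| = (p ^ (2 * r - 2))%N.
Proof.
pose D := ~: [set i0; ir].
have -> : #|restset| = #|pffun_on (ord0 : 'I_p) (mem D) predT|.
  apply: eq_card => m; rewrite inE; apply/andP/pffun_onP.
    move=> [/eqP m0 /eqP mr]; split=> //; apply/subsetP => k.
    rewrite !inE; apply: contra => /orP[] /eqP ->; by apply/eqP.
  move=> [/subsetP h _]; split; apply/negPn/negP => hh.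
    by have := h i0 hh; rewrite !inE eqxx.
  by have := h ir hh; rewrite !inE eqxx orbT.
rewrite card_pffun_on card_ord; congr (p ^ _)%N.
have := cardsC [set i0; ir]; rewrite cards2 eq_sym ir_neq_i0 /= card_ord => e.
have -> : #|mem D| = #|D| by apply: eq_card.
by rewrite -[in RHS]e addKn.
Qed.

Hypothesis hp2 : (2 < p)%N.

(* [(j, m)] encodes the row of all x^l y^j m; the two special rows lose the
   constant 1 and the top monomial. *)
Definition special0 (c : 'I_p * mono p r) := (c.1 == ord0) && (c.2 == mzero).
Definition specialt (c : 'I_p * mono p r) := (c.1 == ord_max) && (c.2 == mtop).

Definition block (c : 'I_p * mono p r) : seq (mono p r) :=
  if special0 c then [seq row_mono (lift ord0 l) c.1 c.2 | l : 'I_q]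
  else if specialt c then [seq row_mono (widen_ord (leqnSn q) l) c.1 c.2 | l : 'I_q]
  else [seq row_mono l c.1 c.2 | l : 'I_p].

Lemma row_mono_inj j m : injective (fun l => row_mono l j m).
Proof. by move=> l l' /(congr1 (fun f : mono p r => f i0)); rewrite !row_mono_i0. Qed.

Lemma widen_inj : injective (widen_ord (leqnSn q)).
Proof. by move=> l l' /(congr1 val) /= e; apply: val_inj. Qed.

Lemma block_uniq c : uniq (block c).
Proof.
rewrite /block; case: ifP => _; last case: ifP => _.
- by rewrite map_inj_uniq -?enumT ?enum_uniq // => l l' /row_mono_inj/lift_inj.
- by rewrite map_inj_uniq -?enumT ?enum_uniq // => l l' /row_mono_inj/widen_inj.
- by rewrite map_inj_uniq -?enumT ?enum_uniq //; apply: row_mono_inj.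
Qed.

Lemma block_row_mono c (al : mono p r) : al \in block c -> exists l, al = row_mono l c.1 c.2.
Proof.
rewrite /block; case: ifP => _; last case: ifP => _.
- by case/mapP=> l _ ->; exists (lift ord0 l).
- by case/mapP=> l _ ->; exists (widen_ord (leqnSn q) l).
- by case/mapP=> l _ ->; exists l.
Qed.

Definition key (al : mono p r) := (al ir, rest al).

Lemma block_key c (al : mono p r) : c.2 \in restset -> al \in block c -> key al = c.
Proof.
by case: c => j m mQ /block_row_mono[l ->]; rewrite /key row_mono_ir rest_row_mono.
Qed.

Lemma mono_nonzeroP (al : mono p r) : reflect (al = mzero) (~~ mono_nonzero al).
Proof.
apply: (iffP idP) => [|->]; last first.
  by apply/existsP => -[k]; rewrite ffunE.
rewrite negb_exists => /forallP h; apply/ffunP => k; rewrite ffunE.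
by apply: val_inj; apply/eqP; rewrite -[_ == _]negbK h.
Qed.

Lemma row_mono_mzero : row_mono ord0 ord0 mzero = mzero.
Proof. by apply/ffunP => k; rewrite !ffunE; case: ifP => // _; case: ifP. Qed.

Lemma row_mono_mtop : row_mono ord_max ord_max mtop = [ffun=> ord_max].
Proof.
by apply/ffunP => k; rewrite !ffunE; case: eqP => //= _; case: eqP.
Qed.

Lemma mono_nontopP (al : mono p r) : reflect (al = [ffun=> ord_max]) (~~ mono_nontop al).
Proof.
apply: (iffP idP) => [|->]; last first.
  by apply/existsP => -[k]; rewrite ffunE /= eqxx.
rewrite negb_exists => /forallP h; apply/ffunP => k; rewrite ffunE.
by apply: val_inj; apply/eqP; rewrite -[_ == _]negbK h.
Qed.

Lemma rest_mzero : rest mzero = mzero.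
Proof. by apply/ffunP => k; rewrite !ffunE if_same. Qed.

Lemma rest_top : rest [ffun=> ord_max] = mtop.
Proof. by apply/ffunP => k; rewrite !ffunE. Qed.

Lemma mem_block c (al : mono p r) : c.2 \in restset ->
  (al \in block c) = [&& key al == c, mono_nonzero al & mono_nontop al].
Proof.
move=> cQ; apply/idP/and3P => [alc|[/eqP <- nz nt]].
  rewrite (block_key cQ alc) eqxx; split=> //.
    apply: contraT => /mono_nonzeroP e; move: (alc) (block_key cQ alc).
    rewrite e /key rest_mzero ffunE => h ke; move: h; rewrite -ke /block /special0 /= !eqxx /=.
    by case/mapP=> l _ /(congr1 (fun f : mono p r => val (f i0))); rewrite row_mono_i0 ffunE.
  apply: contraT => /mono_nontopP e; move: (alc) (block_key cQ alc).
  rewrite e /key rest_top ffunE => h ke; move: h; rewrite -ke.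
  rewrite /block /special0 /specialt /= eq_sym (ord0_neq_max hp2) /= !eqxx /=.
  case/mapP=> l _ /(congr1 (fun f : mono p r => val (f i0))); rewrite row_mono_i0 ffunE /=.
  by have := ltn_ord l; lia.
rewrite /block /special0 /specialt /=.
case: ifP => [/andP[/eqP e1 /eqP e2]|_]; last case: ifP => [/andP[/eqP e1 /eqP e2]|_].
- case: (unliftP ord0 (al i0)) => [l e|e].
    by apply/mapP; exists l; rewrite ?mem_enum // -e row_mono_rest.
  suff /mono_nonzeroP : al = mzero by rewrite nz.
  by rewrite -(row_mono_rest al) e e1 e2 row_mono_mzero.
- have [lq|ql] := ltnP (al i0) q.
    apply/mapP; exists (Ordinal lq); rewrite ?mem_enum //.
    rewrite -[LHS]row_mono_rest; congr row_mono; exact: val_inj.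
  suff /mono_nontopP : al = [ffun=> ord_max] by rewrite nt.
  rewrite -(row_mono_rest al) e1 e2 -row_mono_mtop.
  by congr row_mono; apply: val_inj => /=; have := ltn_ord (al i0); lia.
- by apply/mapP; exists (al i0); rewrite ?mem_enum // row_mono_rest.
Qed.

(** Rows in the order of [summands]: y-degree j contributes the weight p - 1 - j, so V(0) comes from
    j = p - 1, L(i) from j = p - 1 - i and V(p-1) from j = 0. The two special rows close the
    list. *)
Definition codes : seq ('I_p * mono p r) :=
  [seq (ord_max, m) | m <- enum (restset :\ mtop)] ++
  flatten [seq [seq (inord (q - i), m) | m <- enum restset] | i <- iota 1 (p - 2)] ++
  [seq (ord0, m) | m <- enum (restset :\ mzero)] ++
  [:: (ord0, mzero); (ord_max, mtop)].

Lemma mem_codes c : (c \in codes) = (c.2 \in restset).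
Proof.
case: c => j m; rewrite !mem_cat mem_seq2 /=; apply/idP/idP.
  case/or4P => [/mapP[m']|/flatten_mapP[i _ /mapP[m']]|/mapP[m']|].
  - by rewrite mem_enum in_setD1 => /andP[_ ?] [_ ->].
  - by rewrite mem_enum => ? [_ ->].
  - by rewrite mem_enum in_setD1 => /andP[_ ?] [_ ->].
  - by case/orP=> /eqP[_ ->]; rewrite ?mzero_in ?mtop_in.
move=> mQ; apply/or4P.
have [j0|j0] := eqVneq j ord0.
  have [m0|m0] := eqVneq m mzero; first by apply: Or44; rewrite j0 m0 eqxx.
  by apply: Or43; apply/mapP; exists m; rewrite ?j0 // mem_enum in_setD1 m0.
have [jt|jt] := eqVneq j ord_max.
  have [mt|mt] := eqVneq m mtop; first by apply: Or44; rewrite jt mt eqxx orbT.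
  by apply: Or41; apply/mapP; exists m; rewrite ?jt // mem_enum in_setD1 mt.
apply: Or42; apply/flatten_mapP; exists (q - j)%N.
  by rewrite mem_iota; move: j0 jt (ltn_ord j); rewrite -!val_eqE /=; lia.
apply/mapP; exists m; rewrite ?mem_enum //; congr pair; apply: val_inj.
by rewrite /= inordK subKn //; have := ltn_ord j; lia.
Qed.

Lemma size_codes : size codes = (p * #|restset|)%N.
Proof.
rewrite !size_cat !size_map -!cardE size_flatten /shape -map_comp.
rewrite (map_nseq_in (x := #|restset|)) => [|i _ /=]; last by rewrite size_map -cardE.
rewrite sumn_nseq size_iota /=.
have := cardsD1 mtop restset; have := cardsD1 mzero restset.
rewrite mzero_in mtop_in /=; move: hp2; nia.
Qed.

(** By counting: with N elements in [restset], the length is 2 (N - 1) + (p - 2) N + 2 = p N, the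
    number of pairs that the list covers. *)
Lemma codes_uniq : uniq codes.
Proof.
apply: (@leq_size_uniq _ (enum (setX [set: 'I_p] restset))).
- exact: enum_uniq.
- by move=> c; rewrite mem_enum mem_codes inE => /andP[].
- by rewrite size_codes -cardE cardsX cardsT card_ord.
Qed.

Definition monos := flatten (map block codes).

Lemma monos_uniq : uniq monos.
Proof.
apply: (uniq_flatten_key (key := key) codes_uniq) => c cc.
  exact: block_uniq.
by move=> al; apply: block_key; rewrite -mem_codes.
Qed.

Lemma mem_monos (al : mono p r) : (al \in monos) = mono_nonzero al && mono_nontop al.
Proof.
apply/flatten_mapP/idP => [[c cc]|h].
  by rewrite mem_block -?mem_codes // => /and3P[_ -> ->].
exists (key al); first by rewrite mem_codes rest_in.
by rewrite mem_block ?rest_in // eqxx.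
Qed.

End Monomials.

(** * The rows as W(1)-modules *)

Section Rows.
Variables (F : fieldType) (q r : nat).
Local Notation p := q.+1.
Local Notation W := (Wt F p r).
Variables (i0 ir : 'I_(2 * r)).
Hypotheses (vi0 : val i0 = 0%N) (vir : val ir = r) (hp2 : (2 < p)%N).

Lemma monos_span : <<map (@DHm F p r) (monos q i0 ir)>>%VS = Hspace F p r.
Proof.
apply: eq_span => x; apply/mapP/mapP => -[al h ->]; exists al => //.
  by rewrite mem_filter mem_enum andbT -(mem_monos vi0 vir hp2).
by rewrite (mem_monos vi0 vir hp2); move: h; rewrite mem_filter => /andP[].
Qed.

Hypothesis hchar : p \in [pchar F].

Definition rowv j m l : W := DHm F (row_mono i0 ir l j m).

(** This concerns complete rows, so in the special ones it also involves D_H(1) = 0 and D_H of the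
    top monomial; the shortened rows are treated by restricting it. *)
Lemma hact_rowv j m a i :
  hact a (rowv j m i) = \sum_l densM F j a i l *: rowv j m l.
Proof.
have hp1 : (1 < p)%N by lia.
rewrite (hact_DHm vi0 vir hp1 a _ hchar); apply: eq_bigr => l _.
rewrite mxE row_mono_i0 (row_mono_ir vi0 vir); congr (_ *: DHm F _).
by apply/ffunP => k; rewrite !ffunE; case: eqP.
Qed.

Lemma monos_free : free (map (@DHm F p r) (monos q i0 ir)).
Proof.
apply: DHm_free => //; first exact: monos_uniq.
by move=> al; rewrite (mem_monos vi0 vir hp2) => /andP[].
Qed.

Lemma block_free c : c.2 \in restset q i0 ir -> free (map (@DHm F p r) (block i0 ir c)).
Proof.
move=> cQ; apply: DHm_free => //; first exact: block_uniq.
by move=> al; rewrite (mem_block vi0 vir hp2) // => /and3P[].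
Qed.
End Rows.

Section Blocks.
Variables (F : fieldType) (q r : nat).
Local Notation p := q.+1.
Local Notation I := 'I_(2 * r).
Local Notation W := (Wt F p r).
Variables (b : 'I_p -> W) (j : nat).
Hypotheses (hchar : p \in [pchar F])
  (act : forall a i, hact a (b i) = \sum_l densM F j a i l *: b l).
Let bS (l : 'I_q) := b (lift ord0 l).
Let bW (l : 'I_q) := b (widen_ord (leqnSn q) l).

Lemma quot_iso_nil n (rho : 'I_p -> 'M[F]_n) (c : 'I_n -> W) :
  free [seq c k | k : 'I_n] ->
  (forall a k, hact a (c k) = \sum_l rho a k l *: c l) ->
  quot_iso 0%VS <<[seq c k | k : 'I_n]>>%VS (WMod rho).
Proof.
move=> fc h; rewrite -(span_nil W); apply: (quot_iso_cat (s := [::])) => //.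
by move=> a k; rewrite h subrr mem0v.
Qed.

Lemma hact_bS a (i : 'I_q) : j = 0%N -> hact a (bS i) =
  densM F j a (lift ord0 i) ord0 *: b ord0 + \sum_l densN F a i l *: bS l.
Proof.
move=> j0; rewrite act big_ord_recl; congr (_ + _); apply: eq_bigr => l _.
by rewrite !mxE /= /bump !leq0n !add1n addSn addSn eqSS j0 muln0 subr0.
Qed.

Lemma densM_max_col a (i : 'I_p) : j = q -> densM F j a i ord_max = 0.
Proof.
move=> jq; rewrite mxE /=; case: eqP => // e.
have -> : i%:R - (a * j)%:R = (i + a)%:R - (a * p)%:R :> F.
  by rewrite jq mulnS !natrD; ring.
by rewrite e addn1 natrM (pcharf0 hchar) mulr0 subrr.
Qed.

Lemma hact_max a (i : 'I_p) : j = q -> hact a (b i) =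
  \sum_l densM F j a i (widen_ord (leqnSn q) l) *: bW l.
Proof. by move=> jq; rewrite act big_ord_recr /= densM_max_col // scale0r addr0. Qed.

Lemma hact_bW a (i : 'I_q) : j = q -> hact a (bW i) = \sum_l densS F a i l *: bW l.
Proof.
move=> jq; rewrite hact_max //; apply: eq_bigr => l _; congr (_ *: _).
rewrite !mxE /=; case: ifP => // _.
have -> : (i + a)%:R = i%:R - (a * q)%:R + (a * p)%:R :> F.
  by rewrite mulnS !natrD; ring.
by rewrite (natrM _ a p) (pcharf0 hchar) mulr0 addr0 jq.
Qed.

Lemma seq_bS : [seq b k | k : 'I_p] = b ord0 :: [seq bS k | k : 'I_q].
Proof. by rewrite /image_mem enum_ordSl /= -map_comp. Qed.

Lemma seq_bW : [seq b k | k : 'I_p] = [seq bW k | k : 'I_q] ++ [:: b ord_max].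
Proof. by rewrite /image_mem enum_ordSr map_rcons cats1 -map_comp. Qed.

Lemma seq_one (x : W) : [seq x | k : 'I_1] = [:: x].
Proof. by rewrite /image_mem enum_ordSl enum_ord0. Qed.

Variables (V L : nat -> wmod F p).
Hypotheses (hp2 : (2 < p)%N)
  (hV : forall lam : nat, (lam < p)%N -> is_V lam (V lam))
  (hL : forall lam : nat, (lam < p)%N -> is_Lquot (V lam) (L lam)).

Lemma row_iso_V : (j < p)%N -> free [seq b k | k : 'I_p] ->
  quot_iso 0%VS <<[seq b k | k : 'I_p]>>%VS (V (q - j)).
Proof.
move=> jp fb; apply: quot_iso_wiso (quot_iso_nil fb act).
have := V_iso hchar (lam := q - j) ltac:(lia) (hV (lam := q - j) ltac:(lia)).
by rewrite subKn.
Qed.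

Lemma row_iso_L : (0 < j < q)%N -> free [seq b k | k : 'I_p] ->
  quot_iso 0%VS <<[seq b k | k : 'I_p]>>%VS (L (q - j)).
Proof.
move=> jp fb; apply: quot_iso_wiso (quot_iso_nil fb act).
have := L_iso_mid hchar hp2 hV hL (lam := q - j) ltac:(lia).
by rewrite subKn //; lia.
Qed.

(** In the special row of y-degree 0 the constant is killed by D_H, so that the quotient of M_0 by
    its constants appears as a submodule. *)
Lemma tail_iso_L : j = 0%N -> b ord0 = 0 -> free [seq bS k | k : 'I_q] ->
  quot_iso 0%VS <<[seq bS k | k : 'I_q]>>%VS (L q).
Proof.
move=> j0 b0 fb.
apply: (quot_iso_wiso (M := WMod (@densN F q)) (L_iso_top hchar hp2 hV hL)).
apply: quot_iso_nil => // a k.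
by rewrite hact_bS // b0 scaler0 add0r.
Qed.

Lemma init_iso_L : j = q -> free [seq bW k | k : 'I_q] ->
  quot_iso 0%VS <<[seq bW k | k : 'I_q]>>%VS (L q).
Proof.
move=> jq fb; apply: (quot_iso_wiso (M := WMod (@densS F q))
  (wiso_trans (L_iso_top hchar hp2 hV hL)
  (densN_densS hchar))).
by apply: quot_iso_nil => // a k; rewrite hact_bW.
Qed.

Lemma filt_row0 : j = 0%N -> free [seq b k | k : 'I_p] ->
  filt L 0%VS [:: 0%N; q] <<[seq b k | k : 'I_p]>>%VS.
Proof.
move=> j0 fb; have f0 : free [:: b ord0].
  by move: fb; rewrite seq_bS -cat1s cat_free => /and3P[].
have b0 a : hact a (b ord0) = 0.
  by rewrite act big1 // => l _; rewrite mxE j0 muln0 subrr if_same scale0r.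
exists <<[:: b ord0]>>%VS.
  apply: (quot_iso_wiso (M := WMod (@triv F q)) (L_iso_triv hchar hp2 hV hL)).
  rewrite -(seq_one (b ord0)).
  apply: quot_iso_nil; first by rewrite seq_one.
  by move=> a k; rewrite b0 big1 // => l _; rewrite mxE scale0r.
exists <<[seq b k | k : 'I_p]>>%VS => //.
apply: (quot_iso_wiso (M := WMod (@densN F q)) (L_iso_top hchar hp2 hV hL)).
rewrite seq_bS -cat1s; apply: quot_iso_cat; first by move: fb; rewrite seq_bS.
by move=> a k; rewrite hact_bS // addrK memvZ // memv_span // mem_head.
Qed.

Lemma filt_rowmax : j = q -> free [seq b k | k : 'I_p] ->
  filt L 0%VS [:: q; 0%N] <<[seq b k | k : 'I_p]>>%VS.
Proof.
move=> jq fb; have f0 : free [seq bW k | k : 'I_q].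
  by move: fb; rewrite seq_bW cat_free => /and3P[].
exists <<[seq bW k | k : 'I_q]>>%VS; first exact: init_iso_L.
exists <<[seq b k | k : 'I_p]>>%VS => //.
apply: (quot_iso_wiso (M := WMod (@triv F q)) (L_iso_triv hchar hp2 hV hL)).
rewrite seq_bW -(seq_one (b ord_max)); apply: quot_iso_cat.
  by move: fb; rewrite seq_one seq_bW.
move=> a k; rewrite [X in _ - X]big1 ?subr0 => [|l _]; last by rewrite mxE scale0r.
rewrite hact_max //; apply: memv_suml => l _; apply: memvZ; apply: memv_span.
by apply/mapP; exists l; rewrite ?mem_enum.
Qed.
End Blocks.

(** * Counting summands and composition factors *)

Section Factors.
Variables (q r : nat).
Local Notation p := q.+1.
Variables (i0 ir : 'I_(2 * r)).

(** Listed from the socle upwards, hence the opposite orders for M_0 and M_(p-1). *)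
Definition factors (c : 'I_p * mono p r) : seq nat :=
  if special0 c || specialt i0 ir c then [:: q]
  else if c.1 == ord0 then [:: 0%N; q] else if c.1 == ord_max then [:: q; 0%N]
  else [:: (q - c.1)%N].

Lemma factors_lt x : x \in flatten (map factors (codes q i0 ir)) -> (x < p)%N.
Proof.
case/flatten_mapP=> c _; rewrite /factors.
case: ifP => _; last case: ifP => _; last case: ifP => _.
all: rewrite !inE; first [case/orP|idtac] => /eqP ->; lia.
Qed.

Hypotheses (vi0 : val i0 = 0%N) (vir : val ir = r) (hp2 : (2 < p)%N).

(** The function g is arbitrary so that one computation serves both the list of summands and the
    list of composition factors. *)
Lemma map_codes (T : Type) (g : 'I_p * mono p r -> T) (x0 xq xs : T) (xm : nat -> T) :
  (forall c, g c = if special0 c || specialt i0 ir c then xs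
     else if c.1 == ord0 then x0 else if c.1 == ord_max then xq
     else xm (q - c.1)%N) ->
  map g (codes q i0 ir) = nseq (p ^ (2 * r - 2) - 1) xq ++
    flatten [seq nseq (p ^ (2 * r - 2)) (xm i) | i <- iota 1 (p - 2)] ++
    nseq (p ^ (2 * r - 2) - 1) x0 ++ nseq 2 xs.
Proof.
move=> gE; have n0t : (ord_max == ord0 :> 'I_p) = false.
  by rewrite eq_sym (ord0_neq_max hp2).
have cD m : m \in restset q i0 ir -> #|restset q i0 ir :\ m| = (p ^ (2 * r - 2) - 1)%N.
  move=> mQ; rewrite -(card_restset q vi0 vir) (cardsD1 m (restset q i0 ir)) mQ.
  by rewrite add1n subn1.
rewrite !map_cat; congr (_ ++ (_ ++ (_ ++ _))).
- rewrite -map_comp (map_nseq_in (x := xq)) => [|m].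
    by rewrite -cardE cD // mtop_in.
  rewrite mem_enum in_setD1 /= gE /special0 /specialt /= n0t eqxx /=.
  by case/andP=> /negPf ->.
- rewrite map_flatten -map_comp; congr flatten; apply/eq_in_map => i /=.
  rewrite mem_iota => hi; rewrite -map_comp (map_nseq_in (x := xm i)) => [|m _].
    by rewrite -cardE (card_restset q vi0 vir).
  have vi : val (inord (q - i) : 'I_p) = (q - i)%N by rewrite /= inordK //; lia.
  rewrite /= gE /special0 /specialt /= -!val_eqE vi /=.
  have -> : (q - i == 0)%N = false by lia.
  have -> : (q - i == q)%N = false by lia.
  rewrite /=; congr xm; rewrite /= in vi; rewrite vi; lia.
- rewrite -map_comp (map_nseq_in (x := x0)) => [|m].
    by rewrite -cardE cD // mzero_in.
  rewrite mem_enum in_setD1 /= gE /special0 /specialt /= (ord0_neq_max hp2) ?eqxx /=.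
  by case/andP=> /negPf ->.
- by rewrite /= !gE /special0 /specialt /= !eqxx orbT.
Qed.

(** With N = p^(2r-2): each of the 2 (N - 1) complete rows of y-degree 0 or p - 1 contains L(0) and
    L(p-1) once, and the two special rows bring L(p-1) to 2N. *)
Lemma count_factors j : (j < p)%N ->
  count_mem j (flatten (map factors (codes q i0 ir))) = multL p r j.
Proof.
move=> jp; rewrite (map_codes (x0 := [:: 0%N; q]) (xq := [:: q; 0%N]) (xs := [:: q])
  (xm := fun i => [:: i])) //.
have N0 : (0 < p ^ (2 * r - 2))%N by rewrite expn_gt0.
rewrite !flatten_cat !count_cat; set N := (p ^ _)%N in N0 *.
have cn n s : count_mem j (flatten (nseq n s)) = (n * count_mem j s)%N.
  by rewrite count_flatten map_nseq sumn_nseq mulnC.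
have cm s : count_mem j (flatten (flatten [seq nseq N [:: i] | i <- s])) =
   (N * count_mem j s)%N.
  elim: s => [|i s IH] /=; first by rewrite muln0.
  by rewrite flatten_cat count_cat IH cn /= addn0 mulnDr.
rewrite !cn cm /= (count_uniq_mem _ (iota_uniq _ _)) mem_iota /multL -/N /=.
rewrite !addn0; case: (eqVneq j 0%N) => [->|j0] /=.
  have -> : (q == 0)%N = false by lia.
  by rewrite /=; lia.
case: (eqVneq j q) => [->|jq] /=.
  have -> : (0 < q < 1 + (p - 2))%N = false by lia.
  by rewrite /=; lia.
have -> : (0 < j < 1 + (p - 2))%N by move: j0 jq; lia.
by rewrite /=; lia.
Qed.

End Factors.

(** * The decomposition of H(2r) *)

Section Decomposition.
Variables (F : fieldType) (q r : nat).
Local Notation p := q.+1.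
Local Notation I := 'I_(2 * r).
Local Notation W := (Wt F p r).
Variables (i0 ir : I).
Hypotheses (vi0 : val i0 = 0%N) (vir : val ir = r).
Hypotheses (hp2 : (2 < p)%N) (hchar : p \in [pchar F]).
Variables (V L : nat -> wmod F p).
Hypotheses (hV : forall lam : nat, (lam < p)%N -> is_V lam (V lam))
  (hL : forall lam : nat, (lam < p)%N -> is_Lquot (V lam) (L lam)).

Definition summand (c : 'I_p * mono p r) : wmod F p :=
  if special0 c || specialt i0 ir c then L q
  else if c.1 == ord0 then V q else if c.1 == ord_max then V 0
  else L (q - c.1).

Lemma block_iso (c : 'I_p * mono p r) : c.2 \in restset q i0 ir ->
  quot_iso 0%VS <<map (@DHm F p r) (block i0 ir c)>>%VS (summand c) /\
  filt L 0%VS (factors i0 ir c) <<map (@DHm F p r) (block i0 ir c)>>%VS.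
Proof.
move=> cQ; have := block_free vi0 vir hp2 hchar cQ.
have act := hact_rowv vi0 vir hp2 hchar c.1 c.2.
have one U M : quot_iso 0%VS U (L M) -> quot_iso 0%VS U (L M) /\ filt L 0%VS [:: M] U.
  by move=> h; split=> //; exists U.
have sE n (g : 'I_n -> mono p r) :
  map (@DHm F p r) [seq g l | l : 'I_n] = [seq DHm F (g l) | l : 'I_n].
  by rewrite -map_comp.
rewrite /summand /factors /block.
case: ifP => [s0|ns0] /=; last case: ifP => [st|nst] /=; rewrite sE => fr.
- case/andP: s0 => /eqP e1 /eqP e2; apply: one.
  apply: (tail_iso_L hchar act hp2 hV hL _ _ fr); first by rewrite e1.
  rewrite /rowv e1 e2 row_mono_mzero DHm_DHz /DHz big1 // => i _.
  by rewrite !ffunE mulr0 scale0r.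
- case/andP: st => /eqP e1 /eqP e2; apply: one.
  by apply: (init_iso_L hchar act hp2 hV hL _ fr); rewrite e1.
case: eqP => [e1|n1].
  split; last by apply: (filt_row0 hchar act hp2 hV hL _ fr); rewrite e1.
  by have := row_iso_V hchar act hp2 hV (ltn_ord _) fr; rewrite e1 subn0.
case: eqP => [e2|n2].
  split; last by apply: (filt_rowmax hchar act hp2 hV hL _ fr); rewrite e2.
  by have := row_iso_V hchar act hp2 hV (ltn_ord _) fr; rewrite e2 subnn.
apply: one; apply: (row_iso_L hchar act hp2 hV hL _ fr).
move: n1 n2 => /eqP + /eqP; rewrite -!val_eqE /=.
by have := ltn_ord c.1; lia.
Qed.

Lemma map_summand : map summand (codes q i0 ir) = summands r V L.
Proof. exact: map_codes. Qed.

Lemma blocksE : flatten [seq map (@DHm F p r) (block i0 ir c) | c <- codes q i0 ir] =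
  map (@DHm F p r) (monos q i0 ir).
Proof. by rewrite /monos map_flatten -map_comp. Qed.

Lemma Hspace_filt :
  filt L 0%VS (flatten (map (factors i0 ir) (codes q i0 ir))) (Hspace F p r).
Proof.
rewrite -(monos_span F vi0 vir hp2) -blocksE; apply: filt_flatten.
  by rewrite blocksE; apply: monos_free.
by move=> c; rewrite (mem_codes vi0 vir hp2) => /block_iso[].
Qed.

Lemma decomposition :
  (exists U : 'I_(size (summands r V L)) -> {vspace W},
     (\sum_(i < size (summands r V L)) U i)%VS = Hspace F p r /\
     directv (\sum_(i < size (summands r V L)) U i) /\
     forall i : 'I_(size (summands r V L)),
       sub_iso (U i) (nth (V 0%N) (summands r V L) i)).
Proof.
pose c0 : 'I_p * mono p r := (ord0, mzero q r).
pose g c := map (@DHm F p r) (block i0 ir c).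
pose U (i : nat) := <<g (nth c0 (codes q i0 ir) i)>>%VS.
have sz : size (summands r V L) = size (codes q i0 ir) by rewrite -map_summand size_map.
have sumU : (\sum_(i < size (summands r V L)) U i)%VS = Hspace F p r.
  rewrite -(monos_span F vi0 vir hp2) -blocksE span_flatten big_map.
  by rewrite (big_nth c0) -(big_mkord xpredT U) sz.
exists (fun i => U i); split=> //; split.
  (* Directness is read off from dimensions, which add up because the concatenation of all rows is
     free. *)
  rewrite directvE /= sumU -(monos_span F vi0 vir hp2) -blocksE.
  rewrite -dim_span_flatten; last by rewrite blocksE; apply: monos_free.
  by rewrite big_map (big_nth c0) -(big_mkord xpredT (fun i => \dim (U i))) sz.
move=> i; apply: quot_iso_sub; have ic : (i < size (codes q i0 ir))%N by rewrite -sz.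
move: (nat_of_ord i) ic => k kc; rewrite -map_summand (nth_map c0) //.
have /block_iso[] // : (nth c0 (codes q i0 ir) k).2 \in restset q i0 ir.
by rewrite -(mem_codes vi0 vir hp2) mem_nth.
Qed.
End Decomposition.

Theorem theorem5p4 (F : closedFieldType) (p r : nat)
  (hp : prime p) (hp2 : (2 < p)%N) (hchar : p \in [pchar F]) (hr : (1 <= r)%N)
  (V L : nat -> wmod F p)
  (hV : forall lam : nat, (lam < p)%N -> is_V lam (V lam))
  (hL : forall lam : nat, (lam < p)%N -> is_Lquot (V lam) (L lam)) :
  (* H(2r) = V(0)^(p^(2r-2)-1) (+) (+)_{i=1}^{p-2} L(i)^(p^(2r-2))
             (+) V(p-1)^(p^(2r-2)-1) (+) L(p-1)^2   as W(1)-modules *)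
  (exists U : 'I_(size (summands r V L)) -> {vspace Wt F p r},
     (\sum_(i < size (summands r V L)) U i)%VS = Hspace F p r /\
     directv (\sum_(i < size (summands r V L)) U i) /\
     forall i : 'I_(size (summands r V L)),
       sub_iso (U i) (nth (V 0%N) (summands r V L) i))
  /\
  (* [H(2r)] = (2p^(2r-2)-2)[L(0)] + p^(2r-2) sum_{j=1}^{p-2} [L(j)]
               + 2p^(2r-2)[L(p-1)] *)
  (forall s : seq {vspace Wt F p r}, comp_series (Hspace F p r) s ->
     exists lab : 'I_(size s).-1 -> nat,
       (forall i : 'I_(size s).-1,
          (lab i < p)%N /\
          quot_iso (nth 0%VS s i) (nth 0%VS s i.+1) (L (lab i))) /\
       forall j : nat, (j < p)%N ->
         #|[set i : 'I_(size s).-1 | lab i == j]| = multL p r j).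
Proof.
case: p hp hp2 hchar V L hV hL => [//|q] hp hp2 hchar V L hV hL.
have i0P : (0 < 2 * r)%N by lia.
have irP : (r < 2 * r)%N by lia.
(* The positions of x_1 and x_(r+1), with indices counted from 0. *)
pose i0 := Ordinal i0P; pose ir := Ordinal irP.
have vi0 : val i0 = 0%N by []. have vir : val ir = r by [].
split; first exact: (decomposition vi0 vir hp2 hchar hV hL).
move=> s hs.
have simp x : x \in flatten (map (factors i0 ir) (codes q i0 ir)) -> is_simple (wact (L x)).
  by move=> /(factors_lt) /hL [_ []].
have [lab [h1 h2]] := jordan_holder simp (Hspace_filt vi0 vir hp2 hchar hV hL) hs.
exists lab; split=> [i|j jp]; last by rewrite h2 (count_factors vi0 vir hp2).
by have [/factors_lt ? ?] := h1 i.
Qed.
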